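(* Let $\{p_n\}_{n=0}^\infty$ be a compact type Bochner–Krall system, orthogonal with respect to the compactly supported positive Borel measure $\mu$ on $\mathbb{R}$ and consisting of eigenpolynomials of the differential operator $$\mathfrak{d}=\sum_{k=1}^{N}a_k(x)\frac{d^k}{dx^k}$$ of order $N$. If the convex hull of $\operatorname{supp}\mu$ is the interval $[a,b]$, then $N$ is even and $a_N(x)$ is a constant multiple of $\big((x-a)(x-b)\big)^{N/2}$.
   Context: A real polynomial system is a sequence $\{p_n\}_{n=0}^\infty$ of polynomials with real coefficients in one variable $x$ such that $\deg p_n=n$ for every $n\ge 0$. A real polynomial system is orthogonal with respect to a compactly supported positive Borel measure $\mu$ on $\mathbb{R}$ if, for the inner product $\langle p,q\rangle=\int p(x)q(x)\,d\mu(x)$ on real polynomials, $\langle p_n,p_m\rangle$ is nonzero precisely when $n=m$. A differential operator $\mathfrak{d}=\sum_{k=1}^{N}a_k(x)\frac{d^k}{dx^k}$ of order $N\ge 1$ has complex polynomial coefficients $a_k(x)$, with $a_N$ not identically zero. An eigenpolynomial of $\mathfrak{d}$ is a polynomial $p$ satisfying $\mathfrak{d}p=\lambda p$ for some constant $\lambda$. A polynomial system $\{p_n\}$ is a system of eigenpolynomials of $\mathfrak{d}$ if for every $n\ge 0$ there is a constant $\lambda_n$ with $\mathfrak{d}p_n=\lambda_n p_n$. A compact type Bochner–Krall system (with measure $\mu$ and operator $\mathfrak{d}$) is a real polynomial system which is both orthogonal with respect to a compactly supported positive Borel measure $\mu$ on $\mathbb{R}$ and a system of eigenpolynomials of a differential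 operator $\mathfrak{d}=\sum_{k=1}^{N}a_k(x)\frac{d^k}{dx^k}$ of order $N\ge 1$ with complex polynomial coefficients $a_k(x)$ and $a_N$ not identically zero. *)

(* Defs.v *)
From HB Require Import structures.
From mathcomp Require Import all_boot all_order all_algebra.
From mathcomp Require Import all_classical all_reals all_analysis.
From mathcomp.real_closed Require Import complex.

Set Implicit Arguments.
Unset Strict Implicit.
Unset Printing Implicit Defensive.

Import Order.TTheory GRing.Theory Num.Theory.
Import numFieldNormedType.Exports.
Local Open Scope classical_set_scope.
Local Open Scope ring_scope.

(* A point is in the support iff all its open neighbourhoods have positive
   measure; on the real line this is the smallest closed set whose complement
   is a null set. *)
Definition measure_support (R : realType)
    (mu : {measure set (measurableTypeR R) -> \bar R}) : set R :=
  [set x | forall U : set R, open U -> U x -> (0 < mu U)%E].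

Definition convex_hull (R : realType) (A : set R) : set R :=
  smallest (@convex_set R R^o) A.

(* The real-valued integral is 0 when the extended-real integral is infinite,
   so the condition <p_0, p_0> != 0 below forces mu to be finite; for compactly
   supported mu every polynomial is then integrable. *)
Definition poly_inner (R : realType)
    (mu : {measure set (measurableTypeR R) -> \bar R}) (p q : {poly R}) : R :=
  \int[mu]_x (p.[x] * q.[x]).

(* deg (p n) = n, as size is the degree plus one on nonzero polynomials. *)
Definition polynomial_system (R : realType) (p : nat -> {poly R}) : Prop :=
  forall n, size (p n) = n.+1.

Definition orthogonal_system (R : realType)
    (mu : {measure set (measurableTypeR R) -> \bar R}) (p : nat -> {poly R}) :
    Prop :=
  forall n m, poly_inner mu (p n) (p m) <> 0 <-> n = m.

Definition complexify (R : realType) (q : {poly R}) : {poly R[i]} :=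
  map_poly (real_complex R) q.

(* Only the coefficients a 1, ..., a N are relevant. *)
Definition diff_op (R : realType) (N : nat) (a : nat -> {poly R[i]})
    (q : {poly R[i]}) : {poly R[i]} :=
  \sum_(1 <= k < N.+1) a k * q^`(k).

Definition eigenpolynomial (R : realType) (D : {poly R[i]} -> {poly R[i]})
    (q : {poly R[i]}) : Prop :=
  exists lambda : R[i], D q = lambda *: q.

Record compact_bochner_krall (R : realType)
    (mu : {measure set (measurableTypeR R) -> \bar R}) (N : nat)
    (a : nat -> {poly R[i]}) (p : nat -> {poly R}) : Prop := {
  bk_system : polynomial_system p;
  bk_compact : compact (measure_support mu);
  bk_orthogonal : orthogonal_system mu p;
  bk_order_gt0 : (1 <= N)%N;
  bk_lead_neq0 : a N <> 0;
  bk_eigen : forall n, eigenpolynomial (diff_op N a) (complexify (p n))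
}.

(* Main.v *)
Require Import Defs.
From HB Require Import structures.
From mathcomp Require Import all_boot all_order all_algebra.
From mathcomp Require Import all_classical all_reals all_analysis.
From mathcomp Require Import measurable_realfun ring lra zify.
From mathcomp.real_closed Require Import complex polyrcf.

Set Implicit Arguments.
Unset Strict Implicit.
Unset Printing Implicit Defensive.

Import Order.TTheory GRing.Theory Num.Theory.
Import numFieldNormedType.Exports.
Local Open Scope classical_set_scope.
Local Open Scope ring_scope.

(** The operator acts on a basis of orthogonal polynomials diagonally, with
    eigenvalue a polynomial in [n]. Comparing the two coefficients below the
    leading one in the eigenvalue equation shows that the recurrence
    coefficients of the monic orthogonal polynomials are rational functions of
    [n]; being bounded, they have limits [b] and [c], with corrections in powers
    of [1/n]. The [N]-fold commutator of the operator with multiplication by [x]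
    is [N! a_N]. Computed in the basis, its leading symbol is a multiple of
    [(S - c/S)^N], where [S] is the shift, whereas multiplication by [a_N] has
    symbol [a_N (S + b + c/S)]; hence [a_N ^ 2] is a multiple of
    [((x - b)^2 - 4c)^N]. To identify the roots, note that the operator is
    symmetric: the [N]-fold commutator shows that [N] is even, and the
    [(N-1)]-fold one gives the Pearson equation
    [int (N a_N f' + 2 a_(N-1) f) d mu = 0] for all polynomials [f]. Testing it
    with high powers of an affine function that peaks at an endpoint of the
    support forces [a_N] to vanish there. *)

(** * Coefficients and finite differences of polynomials *)

Lemma coef_mul_top (R : comNzRingType) (p q : {poly R}) (m n : nat) :
  (size p <= m.+1)%N -> (size q <= n.+1)%N ->
  (p * q)`_(m + n) = p`_m * q`_n.
Proof.
move=> sp sq; have lm : (m < (m + n).+1)%N by rewrite ltnS leq_addr.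
rewrite coefM (bigD1 (Ordinal lm)) //= addKn big1 ?addr0 // => i.
rewrite -val_eqE /= => ne.
case: (ltngtP i m) ne => // im _.
- by rewrite [q`__]nth_default ?mulr0 // (leq_trans sq) // ltn_subRL ltn_add2r.
- by rewrite [p`__]nth_default ?mul0r // (leq_trans sp).
Qed.

Lemma monic_coef (R : nzRingType) (Q : {poly R}) q : Q \is monic -> size Q = q.+1 -> Q`_q = 1.
Proof. by rewrite monicE lead_coefE => /eqP + sQ; rewrite sQ. Qed.

Lemma size_mul_leq_sum (R : comNzRingType) (p q : {poly R}) (m n : nat) :
  (size p <= m.+1)%N -> (size q <= n.+1)%N -> (size (p * q)%R <= (m + n).+1)%N.
Proof. by move=> sp sq; apply: leq_trans (size_polyMleq _ _) _; lia. Qed.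

Lemma poly_eq_of_horner_nat (R : numDomainType) (p q : {poly R}) (n0 : nat) :
  (forall n, (n0 <= n)%N -> p.[n%:R] = q.[n%:R]) -> p = q.
Proof.
move=> epq; apply/eqP; rewrite -subr_eq0; apply/eqP.
apply: (@roots_geq_poly_eq0 _ _ [seq i%:R | i <- iota n0 (size (p - q))]).
- rewrite all_map; apply/allP => i; rewrite mem_iota => /andP[hi _] /=.
  by rewrite rootE !hornerE epq // subrr.
- rewrite map_inj_uniq ?iota_uniq // => i j /eqP.
  by rewrite eqr_nat => /eqP.
- by rewrite size_map size_iota.
Qed.

(** In Horner form, the difference of [p * 'X + c] is that of [p] times ['X + 1], plus [p], so each
    degree adds one copy of the top coefficient. For [m = 0] the truncated index is harmless, [p]
    being zero. *)
Lemma size_shift_sub (R : comNzRingType) (p : {poly R}) (m : nat) :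
  (size p <= m.+1)%N -> (size (p \Po ('X + 1) - p)%R <= m)%N /\
  (p \Po ('X + 1) - p)`_m.-1 = m%:R * p`_m.
Proof.
elim/poly_ind: p m => [|p c IH] m sp.
  by rewrite comp_poly0 subr0 size_poly0 !coef0 mulr0.
case: m sp => [|m] sp.
  have -> : p = 0.
    apply/eqP; apply: contraLR sp => p0; rewrite size_MXaddC (negPf p0) /=.
    by rewrite ltnS -ltnNge size_poly_gt0.
  by rewrite mul0r add0r comp_polyC subrr size_poly0 coef0 mul0r.
have spm : (size p <= m.+1)%N.
  by move: sp; rewrite size_MXaddC; case: ifP => [/andP[/eqP-> _]|_ //]; rewrite size_poly0.
have [s1 c1] := IH _ spm.
have -> : (p * 'X + c%:P) \Po ('X + 1) - (p * 'X + c%:P) =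
  (p \Po ('X + 1) - p) * ('X + 1) + p.
  by rewrite comp_polyD comp_polyM comp_polyX comp_polyC; ring.
set dp := _ - p in s1 c1 *; clearbody dp.
split.
- apply: leq_trans (size_polyD _ _) _; rewrite geq_max spm andbT.
  apply: leq_trans (size_polyMleq _ _) _.
  by rewrite size_XaddC; lia.
- rewrite [LHS]/= mulrDr mulr1 !coefD !coefMX coefC /= addr0.
  rewrite [X in _ + X + _]nth_default // addr0; case: m s1 c1 {sp IH spm} => [|m] s1 c1 /=.
    by rewrite add0r mul1r.
  by rewrite c1 -(addn1 m.+1) natrD mulrDl mul1r.
Qed.

(* [ratl e al f]: for large [n], [f n] is a rational function of [n] of degree
   at most [e], and [al] is the coefficient of [n^e] in its expansion at
   infinity. *)
Definition ratl (R : realFieldType) (e : nat) (al : R) (f : nat -> R) : Prop :=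
  exists (P Q : {poly R}) (q n0 : nat),
    [/\ Q \is monic, size Q = q.+1, (size P <= (q + e).+1)%N, P`_(q + e) = al &
        forall n, (n0 <= n)%N -> Q.[n%:R] * f n = P.[n%:R]].

(** * Leading coefficients at infinity of rational functions *)

Section Ratl.
Variable R : realFieldType.
Implicit Types (al be : R) (f g : nat -> R).

Lemma ratl_eventually e al f g n0 :
  (forall n, (n0 <= n)%N -> f n = g n) -> ratl e al f -> ratl e al g.
Proof.
move=> efg [P [Q [q [n1 [mQ sQ sP cP h]]]]].
exists P, Q, q, (maxn n0 n1); split=> // n.
by rewrite geq_max => /andP[h0 h1]; rewrite -efg // h.
Qed.

Lemma ratl_ext e al f g : f =1 g -> ratl e al f -> ratl e al g.
Proof. by move=> efg; apply: (@ratl_eventually _ _ _ _ 0%N). Qed.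

Lemma ratl_poly (P : {poly R}) e : (size P <= e.+1)%N ->
  ratl e P`_e (fun n => P.[n%:R]).
Proof.
move=> sP; exists P, 1, 0%N, 0%N; split; rewrite ?monic1 ?size_poly1 //.
by move=> n _; rewrite hornerE mul1r.
Qed.

Lemma ratl0 e : ratl e 0 (fun=> 0 : R).
Proof.
apply: (@ratl_ext _ _ (fun n => (0 : {poly R}).[n%:R])) => [n|]; first by rewrite horner0.
by have := @ratl_poly 0 e; rewrite coef0 size_poly0; apply.
Qed.

Lemma ratl_const al : ratl 0 al (fun=> al).
Proof.
apply: (@ratl_ext _ _ (fun n => (al%:P).[n%:R])) => [n|]; first by rewrite hornerC.
by have := @ratl_poly al%:P 0; rewrite coefC; apply; exact: size_polyC_leq1.
Qed.

Lemma size_monicM_S (P Q : {poly R}) p q : P \is monic -> Q \is monic ->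
  size P = p.+1 -> size Q = q.+1 -> size (P * Q) = (p + q).+1.
Proof.
by move=> mP mQ sP sQ; rewrite size_monicM ?monic_neq0 // sP sQ addSn addnS.
Qed.

Lemma ratlM e1 e2 al be f g : ratl e1 al f -> ratl e2 be g ->
  ratl (e1 + e2) (al * be) (fun n => f n * g n).
Proof.
move=> [P [Q [q [n0 [mQ sQ sP cP h]]]]] [P' [Q' [q' [n0' [mQ' sQ' sP' cP' h']]]]].
exists (P * P'), (Q * Q'), (q + q')%N, (maxn n0 n0').
have E : (q + q' + (e1 + e2) = (q + e1) + (q' + e2))%N by lia.
split.
- by rewrite monicMl.
- exact: size_monicM_S.
- by rewrite E; exact: size_mul_leq_sum.
- by rewrite E coef_mul_top // cP cP'.
- move=> n; rewrite geq_max => /andP[hn hn'].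
  by rewrite !hornerM -h // -h' //; ring.
Qed.

Lemma ratlD e al be f g : ratl e al f -> ratl e be g ->
  ratl e (al + be) (fun n => f n + g n).
Proof.
move=> [P [Q [q [n0 [mQ sQ sP cP h]]]]] [P' [Q' [q' [n0' [mQ' sQ' sP' cP' h']]]]].
exists (P * Q' + P' * Q), (Q * Q'), (q + q')%N, (maxn n0 n0').
have E : (q + q' + e = (q + e) + q')%N by lia.
have E' : (q + q' + e = (q' + e) + q)%N by lia.
split.
- by rewrite monicMl.
- exact: size_monicM_S.
- apply: leq_trans (size_polyD _ _) _; rewrite geq_max; apply/andP; split.
    by rewrite E; apply: size_mul_leq_sum; rewrite ?sQ'.
  by rewrite E'; apply: size_mul_leq_sum; rewrite ?sQ.
- rewrite coefD {1}E E' !coef_mul_top ?sQ ?sQ' // cP cP'.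
  by rewrite (monic_coef mQ sQ) (monic_coef mQ' sQ') !mulr1.
- move=> n; rewrite geq_max => /andP[hn hn'].
  by rewrite !(hornerM, hornerD) -h // -h' //; ring.
Qed.

Lemma ratlZ e al c f : ratl e al f -> ratl e (c * al) (fun n => c * f n).
Proof. by move=> h; have := ratlM (ratl_const c) h; rewrite add0n. Qed.

Lemma ratlB e al be f g : ratl e al f -> ratl e be g ->
  ratl e (al - be) (fun n => f n - g n).
Proof.
move=> hf hg; have := ratlD hf (ratlZ (-1) hg); rewrite mulN1r.
by apply: ratl_ext => n; rewrite mulN1r.
Qed.

Lemma ratl_sum (I : Type) (r : seq I) e (al : I -> R) (f : I -> nat -> R) :
  (forall i, ratl e (al i) (f i)) ->
  ratl e (\sum_(i <- r) al i) (fun n => \sum_(i <- r) f i n).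
Proof.
move=> h; elim: r => [|i r IH].
  by rewrite big_nil; apply: ratl_ext (ratl0 e) => n; rewrite big_nil.
by rewrite big_cons; apply: ratl_ext (ratlD (h i) IH) => n; rewrite big_cons.
Qed.

Lemma ratl_uniq e al be f : ratl e al f -> ratl e be f -> al = be.
Proof.
move=> [P [Q [q [n0 [mQ sQ sP cP h]]]]] [P' [Q' [q' [n0' [mQ' sQ' sP' cP' h']]]]].
have EP : P * Q' = P' * Q.
  apply: (@poly_eq_of_horner_nat _ _ _ (maxn n0 n0')) => n.
  by rewrite geq_max => /andP[hn hn']; rewrite !hornerM -h // -h' //; ring.
have := congr1 (fun p : {poly R} => p`_(q + e + q')) EP.
rewrite coef_mul_top ?sQ' //.
have -> : (q + e + q' = q' + e + q)%N by lia.
by rewrite coef_mul_top ?sQ // cP cP' !(monic_coef mQ sQ, monic_coef mQ' sQ') !mulr1.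
Qed.

Lemma comp_XaddC_monic (P : {poly R}) c q : P \is monic -> size P = q.+1 ->
  P \Po ('X + c%:P) \is monic /\ size (P \Po ('X + c%:P)) = q.+1.
Proof.
move=> mP sP; rewrite size_comp_poly2 ?size_XaddC //; split=> //.
by rewrite monicE lead_coef_comp ?size_XaddC // lead_coefXaddC expr1n mulr1 -monicE.
Qed.

Lemma size_comp_XaddC_leq (P : {poly R}) c m : (size P <= m)%N ->
  (size (P \Po ('X + c%:P)) <= m)%N.
Proof. by rewrite size_comp_poly2 ?size_XaddC. Qed.

Lemma coef_comp_XaddC_top (P : {poly R}) c m : (size P <= m.+1)%N ->
  (P \Po ('X + c%:P))`_m = P`_m.
Proof.
rewrite leq_eqVlt => /orP[/eqP sP|sP].
  have := @lead_coef_comp _ P ('X + c%:P); rewrite size_XaddC => /(_ isT).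
  by rewrite lead_coefXaddC expr1n mulr1 !lead_coefE size_comp_poly2 ?size_XaddC // sP.
by rewrite !nth_default // size_comp_poly2 ?size_XaddC.
Qed.

(** The bound [n <= (m n).+1] keeps [m n] large when [n] is, so one statement serves both forward
    shifts and the predecessor. *)
Lemma ratl_reindex e al f (c : R) (m : nat -> nat) n0 :
  (forall n, (n0 <= n)%N -> (n <= (m n).+1)%N /\ (m n)%:R = n%:R + c) ->
  ratl e al f -> ratl e al (fun n => f (m n)).
Proof.
move=> hm [P [Q [q [n1 [mQ sQ sP cP h]]]]].
have [mQ' sQ'] := comp_XaddC_monic c mQ sQ.
exists (P \Po ('X + c%:P)), (Q \Po ('X + c%:P)), q, (maxn n0 n1.+1); split=> //.
- exact: size_comp_XaddC_leq.
- by rewrite coef_comp_XaddC_top.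
- move=> n; rewrite geq_max => /andP[/hm[le em] hn1].
  by rewrite !horner_comp !hornerE -em h // -ltnS (leq_trans hn1).
Qed.

Lemma ratl_shift k e al f : ratl e al f -> ratl e al (fun n => f (n + k)%N).
Proof.
apply: (@ratl_reindex _ _ _ k%:R (fun n => n + k)%N 0) => n _.
by rewrite natrD; split=> //; rewrite ltnW // ltnS leq_addr.
Qed.

Lemma ratl_pred e al f : ratl e al f -> ratl e al (fun n => f n.-1).
Proof.
apply: (@ratl_reindex _ _ _ (-1) predn 1) => -[//|n] _.
by rewrite -natr1 addrK.
Qed.

(** Over the common denominator, the numerator is [Q] times the difference of [P] minus [P] times
    the difference of [Q]; its top coefficient is [(q + e + 1) al - q al]. *)
Lemma ratl_diff e al f : ratl e.+1 al f ->
  ratl e (e.+1%:R * al) (fun n => f n.+1 - f n).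
Proof.
move=> [P [Q [q [n0 [mQ sQ sP cP h]]]]].
have [mQ' sQ'] := comp_XaddC_monic 1 mQ sQ.
have [sdP cdP] := size_shift_sub sP.
have [sdQ cdQ] : _ /\ _ := @size_shift_sub _ Q q (eq_leq sQ).
exists ((P \Po ('X + 1) - P) * Q - P * (Q \Po ('X + 1) - Q)),
  ((Q \Po ('X + 1%:P)) * Q), (q + q)%N, n0.
have Q1 := monic_coef mQ sQ.
split.
- by rewrite monicMl.
- exact: size_monicM_S.
- apply: leq_trans (size_polyD _ _) _; rewrite geq_max size_polyN; apply/andP; split.
    apply: leq_trans (size_polyMleq _ _) _; rewrite sQ; move: sdP; set dP := _ - _; move: (size dP) => s; clear; lia.
  apply: leq_trans (size_polyMleq _ _) _.
  by move: sP sdQ; set dQ := _ - Q; move: (size P) (size dQ) => s t; clear; lia.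
- rewrite coefB.
  have {1}-> : (q + q + e = (q + e) + q)%N by lia.
  rewrite coef_mul_top ?sQ //; last by apply: leq_trans sdP _; lia.
  have -> : (q + e = (q + e.+1).-1)%N by lia.
  rewrite cdP Q1 cP.
  case: q sQ sP cP cdP sdP sQ' sdQ cdQ Q1 => [|q] sQ sP cP cdP sdP sQ' sdQ cdQ Q1.
    have -> : Q \Po ('X + 1) - Q = 0 by apply/eqP; rewrite -size_poly_eq0 -leqn0.
    by rewrite mulr0 coef0 subr0 mulr1 add0n.
  have -> : (q.+1 + q.+1 + e = (q.+1 + e.+1) + q)%N by lia.
  by rewrite coef_mul_top // cP cdQ Q1 natrD; ring.
- move=> n hn; have hn1 := h n.+1 (leqW hn); have := h n hn.
  rewrite -!polyC1 !hornerE !horner_comp !hornerE natr1 => e1.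
  by rewrite mulrBr mulrAC hn1 -mulrA e1; ring.
Qed.

(** For one step, the product rule writes the expression as the difference of [g * f] minus shifted
    [g] times the difference of [f]; the leading coefficients [(e + 1) be al] cancel. Larger [k]
    telescopes. *)
Lemma ratl_shift_sub0 (k : nat) be g : ratl 0 be g -> forall e al f,
  ratl e.+1 al f -> ratl e 0 (fun n => (g (n + k)%N - g n) * f n).
Proof.
move=> hg e al f hf; elim: k => [|k IH].
  by apply: ratl_ext (ratl0 e) => n; rewrite addn0 subrr mul0r.
have h1 : ratl e 0 (fun n => (g (n + k).+1 - g (n + k)%N) * f n).
  have hgk := ratl_shift k hg.
  have d1 := ratl_diff (ratlM hgk hf).
  have d2 := ratlM (ratl_shift 1 hgk) (ratl_diff hf).
  have := ratlB d1 d2.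
  have -> : e.+1%:R * (be * al) - be * (e.+1%:R * al) = 0 :> R by ring.
  by apply: ratl_ext => n; rewrite -[in RHS]addSn addn1; ring.
have := ratlD h1 IH; rewrite addr0.
by apply: ratl_ext => n; rewrite addnS; ring.
Qed.
End Ratl.

(** * Rational sequences of unspecified degree, and the bounded ones *)

Definition ratf (R : realFieldType) (f : nat -> R) : Prop :=
  exists e al, ratl e al f.

Section Ratf.
Variable R : realFieldType.
Implicit Types f g : nat -> R.

Lemma ratl_widen k e (al : R) f : ratl e al f -> exists be, ratl (e + k) be f.
Proof.
move=> [P [Q [q [n0 [mQ sQ sP cP h]]]]]; exists P`_(q + (e + k)).
by exists P, Q, q, n0; split=> //; rewrite (leq_trans sP) // ltnS addnA leq_addr.
Qed.

Lemma ratfD f g : ratf f -> ratf g -> ratf (fun n => f n + g n).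
Proof.
move=> [e [al /(ratl_widen _) hf]] [e' [al' /(ratl_widen _) hg]].
have [be {}hf] := hf e'; have [be' {}hg] := hg e.
by rewrite addnC in hg; exists (e + e')%N, (be + be'); exact: ratlD.
Qed.

Lemma ratfM f g : ratf f -> ratf g -> ratf (fun n => f n * g n).
Proof. by move=> [e [al hf]] [e' [al' hg]]; exists (e + e')%N, (al * al'); exact: ratlM. Qed.

Lemma ratfN f : ratf f -> ratf (fun n => - f n).
Proof.
by move=> [e [al /(ratlZ (-1)) hf]]; exists e, (-1 * al);
  apply: ratl_ext hf => n; rewrite mulN1r.
Qed.

Lemma ratfB f g : ratf f -> ratf g -> ratf (fun n => f n - g n).
Proof. by move=> hf /ratfN hg; exact: ratfD. Qed.

Lemma ratf_shift k f : ratf f -> ratf (fun n => f (n + k)%N).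
Proof. by move=> [e [al /(ratl_shift k) h]]; exists e, al. Qed.

Lemma ratf_poly (P : {poly R}) : ratf (fun n => P.[n%:R]).
Proof. by exists (size P), P`_(size P); apply: ratl_poly; exact: leqnSn. Qed.

Lemma ratf_ext f g : f =1 g -> ratf f -> ratf g.
Proof. by move=> efg [e [al h]]; exists e, al; exact: ratl_ext h. Qed.

Lemma ratf_div (Q0 : {poly R}) f g : Q0 != 0 ->
  (forall n, Q0.[n%:R] * f n = g n) -> ratf g -> ratf f.
Proof.
move=> Q0n0 efg [e [al [P [Q [q [n0 [mQ sQ sP cP h]]]]]]].
have QQ0 : Q * Q0 != 0 by rewrite mulf_neq0 // monic_neq0.
pose c := (lead_coef (Q * Q0))^-1; have c0 : c != 0 by rewrite invr_eq0 lead_coef_eq0.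
exists (size P), (c *: P)`_((size (Q * Q0)).-1 + size P).
exists (c *: P), (c *: (Q * Q0)), (size (Q * Q0)).-1, n0; split=> //.
- by rewrite monicE lead_coefZ mulVf // lead_coef_eq0.
- by rewrite size_scale // prednK // size_poly_gt0.
- by rewrite size_scale // leqW // leq_addl.
- by move=> n hn; rewrite !hornerE -mulrA -mulrA efg h.
Qed.

(** If [P] had larger degree, [P ^+ 2 - M ^+ 2 *: Q ^+ 2] would have a positive leading coefficient
    and be positive at large naturals. *)
Lemma size_leq_of_norm_bounded (P Q : {poly R}) (M : R) (n0 : nat) : 
  (forall x : R, exists n : nat, (n0 <= n)%N /\ x <= n%:R) ->
  (forall n, (n0 <= n)%N -> `|P.[n%:R]| <= M * `|Q.[n%:R]|) ->
  (size P <= maxn (size Q) 1)%N.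
Proof.
move=> arch le; rewrite leqNgt; apply/negP; rewrite gtn_max => /andP[sQP sP].
have P0 : P != 0 by rewrite -size_poly_gt0 ltnW.
pose H := P ^+ 2 - M ^+ 2 *: Q ^+ 2.
have sH : (size (M ^+ 2 *: Q ^+ 2) < size (P ^+ 2))%N.
  apply: leq_ltn_trans (size_scale_leq _ _) _.
  apply: leq_ltn_trans (size_poly_exp_leq _ _) _.
  have -> : size (P ^+ 2) = ((size P).-1 * 2).+1.
    by rewrite -size_exp prednK // size_poly_gt0 expf_neq0.
  move: (size P) (size Q) sQP sP => s t; clear; lia.
have lH : 0 < lead_coef H.
  by rewrite lead_coefDl ?size_polyN // lead_coef_exp exprn_even_gt0 //= lead_coef_eq0.
have [x hx] := poly_pinfty_gt_lc lH.
have [n [hn /hx]] := arch x; apply/negP; rewrite -ltNge (le_lt_trans _ lH) //.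
rewrite hornerD hornerN hornerZ !horner_exp subr_le0 -exprMn -[leLHS](real_normK (num_real _)) -[leRHS](real_normK (num_real _)).
rewrite ler_sqr ?nnegrE // (le_trans (le n hn)) // normrM ler_wpM2r //.
exact: ler_norm.
Qed.
End Ratf.

Lemma ratf_bounded (R : archiRealFieldType) (f : nat -> R) (M : R) :
  (forall n, `|f n| <= M) -> ratf f -> exists be, ratl 0 be f.
Proof.
move=> fM [e [al [P [Q [q [n0 [mQ sQ sP cP h]]]]]]].
exists P`_q; exists P, Q, q, n0; rewrite addn0; split=> //.
have -> : q.+1 = maxn (size Q) 1 by rewrite sQ; apply/esym/maxn_idPl.
apply: (@size_leq_of_norm_bounded _ _ _ M n0).
  move=> x; exists (maxn n0 (Num.bound `|x|)); rewrite leq_maxl; split=> //.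
  rewrite (le_trans (ler_norm _)) // (le_trans (ltW (archi_boundP (normr_ge0 x)))) //.
  by rewrite ler_nat (leq_trans _ (leq_maxr _ _)) //.
by move=> n /h <-; rewrite normrM mulrC ler_wpM2r.
Qed.

(** * Differential operators and their commutators with multiplication by X *)

(** The sum starts at order zero, unlike in [diff_op], because commutators produce such a term. *)
Definition dop (R : comNzRingType) (N : nat) (a : nat -> {poly R})
    (f : {poly R}) : {poly R} :=
  \sum_(k < N.+1) a k * f^`(k).

Definition commX (R : comNzRingType) (T : {poly R} -> {poly R}) (f : {poly R}) :
  {poly R} := T ('X * f) - 'X * T f.

Section DiffOp.
Variable R : comNzRingType.
Implicit Types (a : nat -> {poly R}) (f g : {poly R}).

Lemma dop_linear N a c f g : dop N a (c *: f + g) = c *: dop N a f + dop N a g.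
Proof.
rewrite /dop scaler_sumr -big_split /=; apply: eq_bigr => k _.
by rewrite derivnD derivnZ mulrDr scalerAr.
Qed.

Lemma derivn_mulX k f : ('X * f)^`(k.+1) = 'X * f^`(k.+1) + f^`(k) *+ k.+1.
Proof.
by have := derivnMXaddC k f 0; rewrite addr0 mulrC => ->; rewrite addrC mulrC.
Qed.

Lemma commX_dop N a f :
  commX (dop N.+1 a) f = dop N (fun j => a j.+1 *+ j.+1) f.
Proof.
rewrite /commX /dop mulr_sumr -sumrB big_ord_recl !derivn0 mulrCA subrr add0r.
apply: eq_bigr => k _; rewrite !lift0 derivn_mulX mulrDr mulrCA.
by rewrite addrAC subrr add0r mulrnAl mulrnAr.
Qed.

Lemma eq_commX (T T' : {poly R} -> {poly R}) : T =1 T' -> commX T =1 commX T'.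
Proof. by move=> e f; rewrite /commX !e. Qed.

(** Commuting with ['X] is formal differentiation with respect to d/dx, whence the falling
    factorials. *)
Lemma iter_commX_dop k m a f : iter k (@commX R) (dop (m + k) a) f =
  dop m (fun j => a (j + k)%N *+ (j + k) ^_ k) f.
Proof.
elim: k m f => [|k IH] m f /=.
  by rewrite addn0; apply: eq_bigr => k _; rewrite addn0 ffactn0 mulr1n.
rewrite addnS -addSn (eq_commX (IH m.+1)) commX_dop; apply: eq_bigr => j _.
by rewrite addSn -mulrnA addnS ffactnSr -addSn addnK.
Qed.

Lemma iter_commX_dop_top N a f :
  iter N (@commX R) (dop N a) f = (a N * f) *+ N`!.
Proof.
rewrite -{2}(add0n N) iter_commX_dop /dop big_ord1 /= add0n ffactnn.
by rewrite mulrnAl.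
Qed.

Lemma iter_commX_dop_subtop N a f :
  iter N (@commX R) (dop N.+1 a) f =
  (a N.+1 * f^`() *+ N.+1 + a N * f) *+ N`!.
Proof.
rewrite -(add1n N) iter_commX_dop /dop !big_ord_recl big_ord0 /= addr0 /bump /=.
rewrite !add0n add1n ffactnn ?derivn0 ?derivn1 !mulrnAl.
have -> : N.+1 ^_ N = (N.+1 * N`!)%N.
  by rewrite -factS -(ffact_fact (leqnSn N)) subSnn muln1.
by rewrite mulrnDl -mulrnA addrC.
Qed.
End DiffOp.

(** * Orthogonal polynomials and their three-term recurrence *)

Lemma basis_ind (R : fieldType) (p : nat -> {poly R}) (V : {poly R} -> Prop) (m : nat) :
  (forall n, size (p n) = n.+1) -> V 0 ->
  (forall c (f g : {poly R}), V f -> V g -> V (c *: f + g)) ->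
  (forall n, (n < m)%N -> V (p n)) ->
  forall f : {poly R}, (size f <= m)%N -> V f.
Proof.
move=> sp V0 Vlin; elim: m => [|m IH] Vp f sf.
  by move: sf; rewrite leqn0 size_poly_eq0 => /eqP ->.
have lp : (p m)`_m != 0.
  by have := lead_coef_eq0 (p m); rewrite lead_coefE sp /= => ->; rewrite -size_poly_gt0 sp.
pose c := f`_m / (p m)`_m.
have -> : f = c *: p m + (f - c *: p m) by rewrite addrC subrK.
apply: Vlin; first exact: Vp.
apply: IH => [n nm|]; first by apply: Vp; rewrite ltnW.
apply/leq_sizeP => j; rewrite leq_eqVlt => /orP[/eqP <-|mj].
  by rewrite coefB coefZ /c divfK // subrr.
rewrite coefB coefZ !nth_default ?mulr0 ?subr0 ?sp //.
exact: leq_trans sf mj.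
Qed.

Section Orthogonal.
Variables (R : realFieldType) (L : {poly R} -> R) (P : nat -> {poly R}).
Implicit Types f g : {poly R}.
Hypothesis L_lin : forall c f g, L (c *: f + g) = c * L f + L g.
Hypothesis P_monic : forall n, P n \is monic.
Hypothesis P_size : forall n, size (P n) = n.+1.
Hypothesis P_orth : forall n m, n != m -> L (P n * P m) = 0.
Hypothesis P_pos : forall n, 0 < L (P n * P n).

Lemma functional0 : L 0 = 0.
Proof. by have := L_lin 1 0 0; rewrite scaler0 addr0; lra. Qed.
Lemma functionalD f g : L (f + g) = L f + L g.
Proof. by have := L_lin 1 f g; rewrite scale1r mul1r. Qed.
Lemma functionalZ c f : L (c *: f) = c * L f.
Proof. by have := L_lin c f 0; rewrite !addr0 functional0 addr0. Qed.
Lemma functionalN f : L (- f) = - L f.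
Proof. by rewrite -scaleN1r functionalZ mulN1r. Qed.
Lemma functionalB f g : L (f - g) = L f - L g.
Proof. by rewrite functionalD functionalN. Qed.
Lemma functionalMn f n : L (f *+ n) = L f *+ n.
Proof. by elim: n => [|n IH]; rewrite ?mulr0n ?functional0 // !mulrS functionalD IH. Qed.

Lemma orth_low n g : (size g <= n)%N -> L (P n * g) = 0.
Proof.
apply: (basis_ind (p := P) (V := fun g => L (P n * g) = 0)) => //.
- by rewrite mulr0 functional0.
- by move=> c f g1 h1 h2; rewrite mulrDr -scalerAr L_lin h1 h2 mulr0 addr0.
- by move=> m mn; apply: P_orth; rewrite gtn_eqF.
Qed.

Lemma orth_monic n g : g \is monic -> size g = n.+1 ->
  L (P n * g) = L (P n * P n).
Proof.
move=> mg sg; rewrite -[in LHS](subrK (P n) g) mulrDr functionalD orth_low ?add0r //.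
apply/leq_sizeP => j; rewrite coefB leq_eqVlt => /orP[/eqP <-|nj].
  by move: mg (P_monic n); rewrite !monicE !lead_coefE sg P_size /= => /eqP-> /eqP->; rewrite subrr.
by rewrite !nth_default ?subrr ?sg ?P_size.
Qed.

Lemma functional_nondegenerate f :
  (forall j, (j < size f)%N -> L (f * P j) = 0) -> f = 0.
Proof.
move=> h; apply/eqP/negPn/negP => f0; have sf : (0 < size f)%N by rewrite size_poly_gt0.
pose m := (size f).-1; have em : m.+1 = size f by rewrite /m prednK.
pose c := lead_coef f; have c0 : c != 0 by rewrite lead_coef_eq0.
have mf : c^-1 *: f \is monic by rewrite monicE lead_coefZ mulVf.
have := @orth_monic m _ mf; rewrite size_scale ?invr_eq0 // em => /(_ erefl).
rewrite -scalerAr functionalZ mulrC mulrC [P m * f]mulrC h; last by rewrite -em.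
by rewrite mulr0 => /esym/eqP; rewrite gt_eqF.
Qed.

(** These are the coefficients in the row of [P n.+1]; with this shift the recurrence never refers
    to a polynomial below [P 0]. *)
Definition jac_b n := L ('X * P n.+1 * P n.+1) / L (P n.+1 * P n.+1).
Definition jac_c n := L (P n.+1 * P n.+1) / L (P n * P n).

Lemma size_XP n : size ('X * P n) = n.+2.
Proof. by rewrite mulrC size_mulX ?P_size // monic_neq0. Qed.

Lemma monic_XP n : 'X * P n \is monic.
Proof. by rewrite monicMl ?monicX. Qed.

(** The difference of the two sides has degree at most [n + 1], since the leading terms cancel, and
    it pairs to zero with [P 0], ..., [P n.+1]. *)
Lemma jacobi_recurrence n :
  'X * P n.+1 = P n.+2 + jac_b n *: P n.+1 + jac_c n *: P n.
Proof.
have h0 k : L (P k * P k) != 0 by rewrite gt_eqF.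
apply/eqP; rewrite -subr_eq0; apply/eqP; set r := _ - _.
have sr : (size r <= n.+2)%N.
  apply/leq_sizeP => j; rewrite leq_eqVlt => /orP[/eqP <-|nj].
    rewrite /r !(coefB, coefD, coefZ) (nth_default 0 (s := P n.+1)) ?P_size //.
    rewrite (nth_default 0 (s := P n)) ?P_size // !mulr0 !addr0.
    have := monic_XP n.+1; have := P_monic n.+2.
    by rewrite !monicE !lead_coefE size_XP P_size /= => /eqP -> /eqP ->; rewrite subrr.
  by rewrite /r !(coefB, coefD, coefZ) !nth_default ?size_XP ?P_size ?mulr0 ?addr0 ?subr0 // ltnW // ltnW.
apply: functional_nondegenerate => j /leq_trans /(_ sr) jn.
rewrite /r mulrBl !mulrDl -!scalerAl functionalB !functionalD !functionalZ.
rewrite (P_orth (n := n.+2)) ?gtn_eqF // add0r.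
move: jn; rewrite ltnS leq_eqVlt => /orP[/eqP ->|].
  rewrite (P_orth (n := n)) ?ltn_eqF // mulr0 addr0 /jac_b divfK // subrr //.
rewrite ltnS => jn; rewrite (P_orth (n := n.+1)) ?gtn_eqF // mulr0 add0r.
rewrite mulrAC mulrC -mulrA; move: jn; rewrite leq_eqVlt => /orP[/eqP ->|jn].
  by rewrite mulVf // mulr1 orth_monic ?monic_XP ?size_XP ?subrr.
by rewrite (@orth_low n.+1 ('X * P j)) ?size_XP ?ltnS // (@orth_low n (P j)) ?P_size // !mulr0 subrr.
Qed.

Section Bounds.
Variables (l r : R).
Hypothesis L_pos : forall f, (forall x, l <= x <= r -> 0 <= f.[x]) -> 0 <= L f.

Lemma jac_b_bounded n : `|jac_b n| <= `|l| + `|r|.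
Proof.
rewrite /jac_b normrM normfV (gtr0_norm (P_pos _)) ler_pdivrMr //.
have key s : `|s| = 1 -> s * L ('X * P n.+1 * P n.+1) <= (`|l| + `|r|) * L (P n.+1 * P n.+1).
  move=> s1; rewrite -!functionalZ // -subr_ge0 -functionalB //; apply: L_pos => x /andP[lx xr].
  rewrite !(hornerD, hornerN, hornerZ, hornerM, hornerX); set y := _.[x].
  have -> : (`|l| + `|r|) * (y * y) - s * (x * y * y) = (`|l| + `|r| - s * x) * y ^+ 2 by ring.
  rewrite mulr_ge0 ?sqr_ge0 // subr_ge0.
  rewrite (le_trans (ler_norm _)) // normrM s1 mul1r.
  rewrite ler_norml; have := ler_norm r; have := ler_norm (- l).
  have := normr_ge0 r; have := normr_ge0 l; rewrite normrN; lra.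
rewrite ler_norml; apply/andP; split.
  by have := key (-1); rewrite normrN1 mulN1r => /(_ erefl); lra.
by have := key 1; rewrite normr1 mul1r => /(_ erefl); lra.
Qed.

(** Positivity of the square of [P n.+1 - 'X * P n] bounds [L (P n.+1 * P n.+1)] by the pairing of
    ['X * P n] with itself, and [|x| <= |l| + |r|] on the interval. *)
Lemma jac_c_bounded n : `|jac_c n| <= (`|l| + `|r|) ^+ 2.
Proof.
rewrite /jac_c ger0_norm; last by rewrite divr_ge0 // ltW.
rewrite ler_pdivrMr //; set M := _ + _.
have h1 : 0 <= L ((P n.+1 - 'X * P n) ^+ 2).
  by apply: L_pos => x _; rewrite horner_exp sqr_ge0.
have h2 : 0 <= L ((M ^+ 2)%:P * (P n * P n) - ('X * P n) * ('X * P n)).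
  apply: L_pos => x /andP[lx xr].
  rewrite !(hornerD, hornerN, hornerC, hornerM, hornerX); set y := _.[x].
  have -> : M ^+ 2 * (y * y) - x * y * (x * y) = (M ^+ 2 - x ^+ 2) * y ^+ 2 by ring.
  rewrite mulr_ge0 ?sqr_ge0 // subr_ge0 -(real_normK (num_real x)) ler_sqr ?nnegrE //; last first.
    by rewrite addr_ge0.
  rewrite ler_norml; have := ler_norm r; have := ler_norm (- l).
  have := normr_ge0 r; have := normr_ge0 l; rewrite normrN /M; lra.
move: h1 h2; rewrite functionalB // mul_polyC functionalZ //.
have -> : (P n.+1 - 'X * P n) ^+ 2 = P n.+1 * P n.+1 - (P n.+1 * ('X * P n)) *+ 2 + ('X * P n) * ('X * P n) by ring.
rewrite functionalD // functionalB // functionalMn // orth_monic ?monic_XP ?size_XP //.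
by rewrite mulr2n; lra.
Qed.
End Bounds.
End Orthogonal.

(** * Action of a differential operator on monomials *)

Definition ffpoly (R : comNzRingType) (k : nat) : {poly R} :=
  \prod_(j < k) ('X - j%:R%:P).

Lemma horner_ffpoly (R : comNzRingType) k n :
  (ffpoly R k).[n%:R] = (n ^_ k)%:R.
Proof.
rewrite /ffpoly; elim: k => [|k IH]; first by rewrite big_ord0 hornerC ffactn0.
rewrite big_ord_recr hornerM IH ffactnSr natrM hornerXsubC.
have [kn|nk] := leqP k n; first by rewrite natrB.
by rewrite ffact_small // !mul0r.
Qed.

Lemma ffpoly_monic (R : comNzRingType) k : ffpoly R k \is monic.
Proof. by apply: monic_prod => i _; exact: monicXsubC. Qed.

Lemma size_ffpoly (R : comNzRingType) k : size (ffpoly R k) = k.+1.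
Proof.
elim: k => [|k IH]; first by rewrite /ffpoly big_ord0 size_poly1.
rewrite /ffpoly big_ord_recr -/(ffpoly R k) size_monicM ?ffpoly_monic //.
  by rewrite IH size_XsubC addn2.
exact/monic_neq0/monicXsubC.
Qed.

(* The coefficient of [X^(n-i)] in [dop N a 'X^n] is a polynomial in [n]. *)
Definition dop_symbol (R : comNzRingType) (N : nat) (a : nat -> {poly R}) (i : nat) :
    {poly R} :=
  \sum_(k < N.+1) (if (i <= k)%N then (a k)`_(k - i) else 0) *: ffpoly R k.

Lemma coef_dop_Xn (R : comNzRingType) N (a : nat -> {poly R}) i n : (i <= n)%N ->
  (dop N a 'X^n)`_(n - i) = (dop_symbol N a i).[n%:R].
Proof.
move=> le_in; rewrite /dop /dop_symbol coef_sum horner_sum; apply: eq_bigr => k _.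
rewrite hornerZ horner_ffpoly derivnXn mulrnAr coefMn.
have [kn|nk] := leqP k n; last by rewrite ffact_small // mulr0.
rewrite coefMXn; have -> : (n - i < n - k)%N = ~~ (i <= k)%N by lia.
case: leqP => [ik|_] /=; last by rewrite mul0r mul0rn.
by rewrite mulr_natr; congr (_`_ _ *+ _); lia.
Qed.

Lemma coef_dop_symbol0_top (R : comNzRingType) N (a : nat -> {poly R}) :
  (size (dop_symbol N a 0) <= N.+1)%N /\ (dop_symbol N a 0)`_N = (a N)`_N.
Proof.
split.
  apply: (leq_trans (size_sum _ _ _)); apply/bigmax_leqP => k _.
  by rewrite (leq_trans (size_scale_leq _ _)) // size_ffpoly.
rewrite /dop_symbol coef_sum (bigD1 ord_max) //= subn0 big1 ?addr0.
  by rewrite coefZ (monic_coef (ffpoly_monic R N) (size_ffpoly R N)) mulr1.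
move=> k; rewrite -val_eqE /= => kN; rewrite coefZ [X in _ * X]nth_default ?mulr0 //.
by rewrite size_ffpoly; have := ltn_ord k; lia.
Qed.

Lemma iter_commX_eq0 (R : comNzRingType) (T : {poly R} -> {poly R}) k :
  (forall f, T f = 0) -> forall f, iter k (@commX R) T f = 0.
Proof. by move=> T0; elim: k => //= k IH f; rewrite /commX !IH mulr0 subrr. Qed.

Lemma size_iter_commX (R : comNzRingType) (T : {poly R} -> {poly R}) k :
  (forall (f : {poly R}) m, (size f <= m)%N -> (size (T f) <= m)%N) ->
  forall (f : {poly R}) m, (size f <= m)%N ->
    (size (iter k (@commX R) T f) <= m + k)%N.
Proof.
move=> hT; elim: k => [|k IH] f m sf; first by rewrite addn0; exact: hT.
have sX (g : {poly R}) q : (size g <= q)%N -> (size ('X * g)%R <= q.+1)%N.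
  by move=> sg; rewrite (leq_trans (size_polyMleq _ _)) // size_polyX /=.
rewrite /= /commX (leq_trans (size_polyD _ _)) // geq_max size_polyN.
apply/andP; split; first by rewrite addnS -addSn IH ?sX.
by rewrite addnS sX ?IH.
Qed.

(** * Symmetry of the operator and rationality of the recurrence coefficients *)

Section Eigen.
Variables (R : archiRealFieldType) (L : {poly R} -> R) (P : nat -> {poly R}).
Implicit Types f g : {poly R}.
Hypothesis L_lin : forall c f g, L (c *: f + g) = c * L f + L g.
Hypothesis P_monic : forall n, P n \is monic.
Hypothesis P_size : forall n, size (P n) = n.+1.
Hypothesis P_orth : forall n m, n != m -> L (P n * P m) = 0.
Hypothesis P_pos : forall n, 0 < L (P n * P n).
Variables (N : nat) (a : nat -> {poly R}) (lam : nat -> R).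
Hypothesis a0 : a 0 = 0.
Hypothesis aN : a N != 0.
Hypothesis eig : forall n, dop N a (P n) = lam n *: P n.

Lemma dop0 : dop N a 0 = 0.
Proof. by have := dop_linear N a (-1) 0 0; rewrite scaler0 addr0 scaleN1r addNr. Qed.

Lemma dop_lin2 c f g : dop N a (f + c *: g) = dop N a f + c *: dop N a g.
Proof. by rewrite addrC dop_linear addrC. Qed.

Lemma size_dop_eig f m : (size f <= m)%N -> (size (dop N a f) <= m)%N.
Proof.
apply: (basis_ind (p := P) (V := fun f => (size (dop N a f) <= m)%N)) => //.
- by rewrite dop0 size_poly0.
- move=> c f1 g1 h1 h2; rewrite dop_linear (leq_trans (size_polyD _ _)) // geq_max h2 andbT.
  exact: leq_trans (size_scale_leq _ _) h1.
- by move=> n nm; rewrite eig (leq_trans (size_scale_leq _ _)) // P_size.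
Qed.

Lemma dop_sym f g : L (dop N a f * g) = L (f * dop N a g).
Proof.
apply: (basis_ind (p := P) (V := fun f => L (dop N a f * g) = L (f * dop N a g)) (m := size f)) => //.
- by rewrite dop0 !mul0r.
- by move=> c f1 f2 h1 h2; rewrite dop_linear !mulrDl -!scalerAl !L_lin h1 h2.
move=> n _; rewrite eig.
apply: (basis_ind (p := P) (V := fun g => L (lam n *: P n * g) = L (P n * dop N a g)) (m := size g)) => //.
- by rewrite dop0 !mulr0.
- by move=> c f1 f2 h1 h2; rewrite dop_linear !mulrDr -!scalerAr !L_lin h1 h2.
move=> m _; rewrite eig -scalerAl -scalerAr !(functionalZ L_lin).
by have [->//|nm] := eqVneq n m; rewrite P_orth // !mulr0.
Qed.

(** Multiplication by ['X] is symmetric for [L], so each commutator with it exchanges symmetric and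
    skew-symmetric operators. *)
Lemma iter_commX_sym k f g : L (iter k (@commX R) (dop N a) f * g) =
  (-1) ^+ k * L (f * iter k (@commX R) (dop N a) g).
Proof.
elim: k f g => [|k IH] f g /=; first by rewrite mul1r dop_sym.
set T := iter k _ _ in IH *; rewrite /commX mulrBl mulrBr !(functionalB L_lin) IH.
have -> : 'X * T f * g = T f * ('X * g) by ring.
have -> : f * ('X * T g) = 'X * f * T g by ring.
by rewrite IH exprS; ring.
Qed.

(** The [N]-fold commutator is multiplication by [N! a_N], which is symmetric; for odd [N] it is
    also skew-symmetric, and [a N] pairs to zero with every [P j]. *)
Lemma order_even : ~~ odd N.
Proof.
apply/negP => oN; move/eqP: aN; apply; apply: (functional_nondegenerate L_lin P_monic P_size P_orth P_pos) => j _.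
have := iter_commX_sym N 1 (P j); rewrite !iter_commX_dop_top -signr_odd oN expr1.
rewrite !mulrnAl !mulrnAr !(functionalMn L_lin) mulr1 mul1r mulN1r.
set y := L _ *+ _ => ey; have {ey} : y = 0 by lra.
by move/eqP; rewrite mulrn_eq0 -leqn0 leqNgt fact_gt0 => /eqP.
Qed.

(* The [(N-1)]-fold commutator of the operator with multiplication by [X] has
   order one, and it is skew-symmetric as [N] is even. *)
Lemma pearson f : (0 < N)%N -> L (a N * f^`() *+ N + (a N.-1 * f) *+ 2) = 0.
Proof.
case: N aN order_even iter_commX_sym => // M _ /= /negPn oM symT _.
(* Skew-symmetry is tested against 1, whose derivative vanishes, so that only the term in [a M]
   appears on the other side. *)
have := symT M f 1; rewrite !iter_commX_dop_subtop -signr_odd oM expr1 derivC.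
rewrite mulr0 mul0rn add0r !mulr1 mulrnAr !(functionalMn L_lin) mulN1r.
rewrite (functionalD L_lin) -mulNrn => /eqP.
rewrite eqr_pMn2r ?fact_gt0 // mulrC => /eqP h.
by rewrite mulr2n addrA !(functionalD L_lin) h [a M * f]mulrC; lra.
Qed.

Local Notation E := (dop_symbol N a).

(** The operator does not raise degrees, so only the leading monomial of [P n] contributes to the
    coefficient of ['X^n]. *)
Lemma eig_symbol0 n : lam n = (E 0).[n%:R].
Proof.
have := coef_dop_Xn N a (leq0n n); rewrite subn0 => <-.
have Pn1 := monic_coef (P_monic n) (P_size n).
have := congr1 (fun p : {poly R} => p`_n) (eig n); rewrite coefZ Pn1 mulr1 => <-.
have -> : P n = 'X^n + 1 *: (P n - 'X^n) by rewrite scale1r addrC subrK.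
rewrite dop_lin2 coefD coefZ [X in 1 * X]nth_default ?mulr0 ?addr0 //.
apply: size_dop_eig; apply/leq_sizeP => j nj; rewrite coefB coefXn.
by move: nj; rewrite leq_eqVlt => /orP[/eqP <-|nj]; rewrite ?eqxx ?Pn1 ?subrr // nth_default ?P_size // gtn_eqF ?subr0.
Qed.

Definition subcoef1 n := (P n.+1)`_n.
Definition subcoef2 n := (P n.+2)`_n.

Lemma coef_P n : (P n)`_n = 1.
Proof. exact: monic_coef. Qed.

Lemma eig_coef1 n :
  (E 0 \Po ('X + 1%:P) - E 0).[n%:R] * subcoef1 n = (E 1 \Po ('X + 1%:P)).[n%:R].
Proof.
rewrite hornerD hornerN !horner_comp !hornerE natr1 -!eig_symbol0.
rewrite -coef_dop_Xn // subn1 /=.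
have := congr1 (fun p : {poly R} => p`_n) (eig n.+1).
rewrite coefZ -/(subcoef1 n).
(* The last summand has degree below [n], so it drops out of the coefficient of ['X^n]. *)
have {1}-> : P n.+1 = 'X^(n.+1) + subcoef1 n *: 'X^n + 1 *: (P n.+1 - 'X^(n.+1) - subcoef1 n *: 'X^n).
  by rewrite scale1r; ring.
have e0 : (dop N a 'X^n)`_n = lam n.
  by have := coef_dop_Xn N a (leq0n n); rewrite subn0 eig_symbol0.
rewrite !dop_lin2 !coefD !coefZ e0 [X in 1 * X]nth_default.
  by rewrite mulr0 addr0 mulrBl => <-; ring.
apply: size_dop_eig; apply/leq_sizeP => j nj; rewrite !coefB coefZ !coefXn.
move: nj; rewrite leq_eqVlt => /orP[/eqP <-|].
  by rewrite eqxx ltn_eqF // /subcoef1 mulr1 subr0 subrr.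
rewrite leq_eqVlt => /orP[/eqP <-|nj].
  by rewrite eqxx coef_P gtn_eqF // mulr0 subr0 subrr.
by rewrite nth_default ?P_size // !gtn_eqF ?mulr0 ?subr0 // ltnW.
Qed.

Lemma eig_coef2 n :
  (E 0 \Po ('X + 2%:R%:P) - E 0).[n%:R] * subcoef2 n =
  (E 2 \Po ('X + 2%:R%:P)).[n%:R] + subcoef1 n.+1 * (E 1 \Po ('X + 1%:P)).[n%:R].
Proof.
rewrite !(hornerD, hornerN, horner_comp, hornerX, hornerC) natr1 -natrD addn2 -!eig_symbol0.
rewrite -!coef_dop_Xn // subn2 subn1 /=.
have := congr1 (fun p : {poly R} => p`_n) (eig n.+2).
rewrite coefZ -/(subcoef2 n).
have {1}-> : P n.+2 = 'X^(n.+2) + subcoef1 n.+1 *: 'X^(n.+1) + subcoef2 n *: 'X^n +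
    1 *: (P n.+2 - 'X^(n.+2) - subcoef1 n.+1 *: 'X^(n.+1) - subcoef2 n *: 'X^n).
  by rewrite scale1r; ring.
have e0 : (dop N a 'X^n)`_n = lam n.
  by have := coef_dop_Xn N a (leq0n n); rewrite subn0 eig_symbol0.
rewrite !dop_lin2 !coefD !coefZ e0 [X in 1 * X]nth_default.
  by rewrite mulr0 addr0 mulrBl => <-; ring.
apply: size_dop_eig; apply/leq_sizeP => j nj; rewrite !coefB !coefZ !coefXn.
have [->|nej] := eqVneq j n.
  have -> : (n == n.+2) = false by lia.
  have -> : (n == n.+1) = false by lia.
  by rewrite /subcoef2 mulr1 mulr0 !subr0 subrr.
have [->|nej1] := eqVneq j n.+1.
  have -> : (n.+1 == n.+2) = false by lia.
  by rewrite /subcoef1 mulr1 mulr0 !subr0 subrr.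
have [->|nej2] := eqVneq j n.+2; first by rewrite coef_P !mulr0 !subr0 subrr.
by rewrite nth_default ?P_size ?mulr0 ?subr0 //; lia.
Qed.

(** If all eigenvalues vanish then so does the operator, and with it its [N]-fold commutator, which
    sends 1 to [N! a_N]. *)
Lemma symbol0_neq0 : E 0 != 0.
Proof.
apply/eqP => E0; have D0 f : dop N a f = 0.
  apply: (basis_ind (p := P) (V := fun f => dop N a f = 0) (m := size f)) => //.
  - exact: dop0.
  - by move=> c f1 f2 h1 h2; rewrite dop_linear h1 h2 scaler0 addr0.
  - by move=> n _; rewrite eig eig_symbol0 E0 horner0 scale0r.
have := iter_commX_eq0 N D0 1; rewrite iter_commX_dop_top mulr1.
move/(congr1 (fun p : {poly R} => p`_(size (a N)).-1)); rewrite coef0 coefMn => /eqP.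
by rewrite mulrn_eq0 -leqn0 leqNgt fact_gt0 -lead_coefE lead_coef_eq0 (negPf aN).
Qed.

Lemma symbol0_at0 : (E 0).[0] = 0.
Proof.
have := eig_symbol0 0; rewrite /= mulr0n => <-.
have := congr1 (fun p : {poly R} => p`_0) (eig 0); rewrite coefZ coef_P mulr1 => <-.
rewrite /dop big_ord_recl a0 mul0r add0r coef_sum big1 // => i _.
by rewrite [P 0]size1_polyC ?P_size // derivnC lift0 mulr0 coef0.
Qed.

(** A polynomial of period [s] that vanishes at 0 vanishes at all multiples of [s], hence is
    zero. *)
Lemma symbol0_shift_neq0 s : (0 < s)%N -> E 0 \Po ('X + s%:R%:P) - E 0 != 0.
Proof.
move=> s0; apply: contra symbol0_neq0 => /eqP e.
have h m : (E 0).[(m * s)%:R] = 0.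
  elim: m => [|m IH]; first by rewrite mul0n symbol0_at0.
  rewrite -IH; apply/eqP; rewrite -subr_eq0; apply/eqP.
  have := congr1 (fun p : {poly R} => p.[(m * s)%:R]) e.
  by rewrite !(hornerD, hornerN, horner_comp, hornerX, hornerC) -natrD mulSn addnC.
have : E 0 \Po (s%:R *: 'X) = 0.
  apply: (@poly_eq_of_horner_nat _ _ _ 0) => n _.
  by rewrite horner_comp !hornerE -natrM mulnC h.
move/eqP; rewrite comp_poly2_eq0 // size_scale ?size_polyX //.
by rewrite pnatr_eq0 -lt0n.
Qed.

Lemma ratf_subcoef1 : ratf subcoef1.
Proof. exact: ratf_div (symbol0_shift_neq0 (ltn0Sn 0)) eig_coef1 (ratf_poly _). Qed.

Lemma ratf_subcoef2 : ratf subcoef2.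
Proof.
apply: ratf_div (symbol0_shift_neq0 (ltn0Sn 1)) eig_coef2 _.
apply: ratfD; first exact: ratf_poly.
apply: ratfM; last exact: ratf_poly.
by apply: ratf_ext (ratf_shift 1 ratf_subcoef1) => n; rewrite addn1.
Qed.

Local Notation b := (jac_b L P).
Local Notation c := (jac_c L P).
Let recurrence := jacobi_recurrence L_lin P_monic P_size P_orth P_pos.

Lemma jac_b_subcoef n : b n = subcoef1 n - subcoef1 n.+1.
Proof.
have := congr1 (fun p : {poly R} => p`_n.+1) (recurrence n).
rewrite coefXM /= !coefD !coefZ coef_P [(P n)`__]nth_default ?P_size //.
by rewrite -!/(subcoef1 _); lra.
Qed.

Lemma jac_c_subcoef n :
  c n.+1 = subcoef2 n - subcoef2 n.+1 - b n.+1 * subcoef1 n.+1.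
Proof.
have := congr1 (fun p : {poly R} => p`_n.+1) (recurrence n.+1).
rewrite coefXM /= !coefD !coefZ coef_P -!/(subcoef1 _) -!/(subcoef2 _) mulr1.
by move=> ->; ring.
Qed.

Lemma ratf_jac_b : ratf b.
Proof.
apply: ratf_ext (fsym jac_b_subcoef) _.
apply: ratfB ratf_subcoef1 _.
by apply: ratf_ext (ratf_shift 1 ratf_subcoef1) => n; rewrite addn1.
Qed.

Lemma ratf_jac_c : ratf c.
Proof.
have s1 (u : nat -> R) : ratf u -> ratf (fun n => u n.+1).
  by move/(ratf_shift 1); apply: ratf_ext => n; rewrite addn1.
(* The formula reaches only [c n.+1]; going back one index loses [c 0], which does not affect the
   behaviour at infinity. *)
have [e [al /ratl_pred h]] : ratf (fun n => c n.+1).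
  apply: ratf_ext (fsym jac_c_subcoef) _.
  apply: ratfB; first exact: ratfB ratf_subcoef2 (s1 _ ratf_subcoef2).
  exact: ratfM (s1 _ ratf_jac_b) (s1 _ ratf_subcoef1).
by exists e, al; apply: (ratl_eventually (n0 := 1) _ h) => -[].
Qed.

Lemma ratl_eigenvalue : ratl N (a N)`_N lam.
Proof.
have [sE cE] := coef_dop_symbol0_top N a; rewrite -cE.
by apply: ratl_ext (ratl_poly sE) => n; rewrite eig_symbol0.
Qed.

(** The operator does not raise degrees and each commutator raises them by at most one; the [N]-fold
    one sends 1 to [N! a_N]. *)
Lemma size_lead_leq : (size (a N) <= N.+1)%N.
Proof.
have := @size_iter_commX _ (dop N a) N size_dop_eig 1 1.
rewrite size_poly1 add1n => /(_ isT); rewrite iter_commX_dop_top mulr1.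
by rewrite -scaler_nat size_scale // pnatr_eq0 -lt0n fact_gt0.
Qed.
End Eigen.

(** * Leading symbols of operators in the orthogonal basis *)

Lemma commX_linear (R : comNzRingType) (T : {poly R} -> {poly R}) :
  (forall c f g, T (c *: f + g) = c *: T f + T g) ->
  forall c f g, commX T (c *: f + g) = c *: commX T f + commX T g.
Proof.
move=> hT c f g; rewrite /commX mulrDr -scalerAr !hT mulrDr -scalerAr.
by rewrite scalerBr opprD addrACA.
Qed.

Section Symbol.
Variables (R : archiRealFieldType) (L : {poly R} -> R) (P : nat -> {poly R}).
Implicit Types f g : {poly R}.
Hypothesis L_lin : forall c f g, L (c *: f + g) = c * L f + L g.
Hypothesis P_monic : forall n, P n \is monic.
Hypothesis P_size : forall n, size (P n) = n.+1.
Hypothesis P_orth : forall n m, n != m -> L (P n * P m) = 0.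
Hypothesis P_pos : forall n, 0 < L (P n * P n).

Local Notation b := (jac_b L P).
Local Notation c := (jac_c L P).
Local Notation h n := (L (P n * P n)).
Let recurrence := jacobi_recurrence L_lin P_monic P_size P_orth P_pos.

(** The coefficient of [P m] in the expansion of [T (P n)]. *)
Definition entry (T : {poly R} -> {poly R}) n m := L (T (P n) * P m) / h m.

Lemma entry_diag (lam : nat -> R) T n m : (forall k, T (P k) = lam k *: P k) ->
  entry T n m = if n == m then lam n else 0.
Proof.
move=> hT; rewrite /entry hT -scalerAl (functionalZ L_lin).
have [->|nm] := eqVneq n m; first by rewrite mulfK ?gt_eqF.
by rewrite (P_orth nm) mulr0 mul0r.
Qed.

Lemma entry_XP T n m : (forall d f g, T (d *: f + g) = d *: T f + T g) ->
  entry (fun f => T ('X * f)) n.+1 m =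
  entry T n.+2 m + b n * entry T n.+1 m + c n * entry T n m.
Proof.
move=> hT; rewrite /entry recurrence.
have -> : P n.+2 + b n *: P n.+1 + c n *: P n =
  c n *: P n + (b n *: P n.+1 + P n.+2) by rewrite addrC [in LHS](addrC (P _)).
have hL d f g : L (T (d *: f + g) * P m) = d * L (T f * P m) + L (T g * P m).
  by rewrite hT mulrDl -scalerAl L_lin.
by rewrite !hL; ring.
Qed.

(** Symmetry moves ['X] onto [P m.+1]; the normalisations [h] then turn the recurrence into its
    transpose. *)
Lemma entry_XM T n m :
  entry (fun f => 'X * T f) n m.+1 =
  c m.+1 * entry T n m.+2 + b m * entry T n m.+1 + entry T n m.
Proof.
have h0 k : h k != 0 by rewrite gt_eqF.
rewrite /entry.
have -> : 'X * T (P n) * P m.+1 = T (P n) * ('X * P m.+1) by ring.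
have -> : 'X * P m.+1 = c m *: P m + (b m *: P m.+1 + P m.+2).
  by rewrite recurrence addrC [in LHS](addrC (P _)).
have hL d f g : L (T (P n) * (d *: f + g)) = d * L (T (P n) * f) + L (T (P n) * g).
  by rewrite mulrDr -scalerAr L_lin.
by rewrite !hL /jac_c; field; rewrite ?h0.
Qed.

Lemma entry_commX T n m : (forall d f g, T (d *: f + g) = d *: T f + T g) ->
  entry (commX T) n.+1 m.+1 =
  entry T n.+2 m.+1 + b n * entry T n.+1 m.+1 + c n * entry T n m.+1 -
  (c m.+1 * entry T n.+1 m.+2 + b m * entry T n.+1 m.+1 + entry T n.+1 m).
Proof.
move=> hT; rewrite -entry_XP // -entry_XM /entry /commX.
by rewrite [(_ - _) * _]mulrBl (functionalB L_lin) mulrBl.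
Qed.

Variables (b0 c0 : R).
Hypotheses (hb : ratl 0 b0 b) (hc : ratl 0 c0 c).

Lemma ratl_jac_sub0 (u w : nat -> R) be i j e al : ratl 0 be u ->
  ratl e.+1 al w -> ratl e 0 (fun n => (u (n + i)%N - u (n + j)%N) * w n).
Proof.
move=> hu hf; have := ratlB (ratl_shift_sub0 i hu hf) (ratl_shift_sub0 j hu hf).
by rewrite subr0; apply: ratl_ext => n; ring.
Qed.

(** This is [X^K (X - c0 / X)^k], and [mul_symbol] is [X^K (X + b0 + c0 / X)^k]; the factor [X^K]
    clears the negative powers of the shift. *)
Definition comm_symbol K k : {poly R} := 'X^(K - k) * ('X^2 - c0%:P) ^+ k.
Definition mul_symbol K k : {poly R} :=
  'X^(K - k) * ('X^2 + b0 *: 'X + c0%:P) ^+ k.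

Lemma coef_comm_symbolS K k i : (k < K)%N ->
  (comm_symbol K k.+1)`_i.+1 =
  (comm_symbol K k)`_i - c0 * (comm_symbol K k)`_i.+2.
Proof.
move=> kK.
have e : 'X * comm_symbol K k.+1 = 'X^2 * comm_symbol K k - c0 *: comm_symbol K k.
  by rewrite /comm_symbol -(subnSK kK) !exprS -mul_polyC; ring.
have := congr1 (fun p : {poly R} => p`_i.+2) e.
by rewrite coefXM coefB coefZ (@coefXnM _ 2) subn2.
Qed.

Lemma coef_mul_symbolS K k i : (k < K)%N ->
  (mul_symbol K k.+1)`_i.+1 =
  (mul_symbol K k)`_i + b0 * (mul_symbol K k)`_i.+1 + c0 * (mul_symbol K k)`_i.+2.
Proof.
move=> kK.
have e : 'X * mul_symbol K k.+1 = 'X^2 * mul_symbol K k + b0 *: ('X * mul_symbol K k)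
    + c0 *: mul_symbol K k.
  by rewrite /mul_symbol -(subnSK kK) !exprS -!mul_polyC; ring.
have := congr1 (fun p : {poly R} => p`_i.+2) e.
by rewrite coefXM !coefD !coefZ (@coefXnM _ 2) coefXM subn2.
Qed.

Variables (N : nat) (a : nat -> {poly R}) (lam : nat -> R).
Hypothesis eig : forall n, dop N a (P n) = lam n *: P n.
Hypothesis lamN : ratl N (a N)`_N lam.
Local Notation T k := (iter k (@commX R) (dop N a)).

Lemma iter_commX_linear k d f g : T k (d *: f + g) = d *: T k f + T k g.
Proof.
elim: k d f g => [|k IH] d f g /=; first exact: dop_linear.
exact: commX_linear.
Qed.

(* With respect to the basis [P], commutation with the Jacobi matrix
   [S + b + c S^-1] lowers the order in [n] by one and multiplies the leading
   symbol by the exponent times [S - c S^-1]; the diagonal [m = n + j] is the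
   coefficient of [S^j], here stored as the coefficient of [X^(K+j)]. *)
Lemma ratl_entry_commX K k i : (k <= K)%N -> (k <= N)%N -> (k <= i)%N ->
  ratl (N - k) ((a N)`_N * (N ^_ k)%:R * (comm_symbol K k)`_i)
    (fun n => entry (T k) (n + K) (n + i)).
Proof.
elim: k K i => [|k IH] K i kK kN ki.
  rewrite subn0 ffactn0 mulr1 /comm_symbol expr0 mulr1 subn0 coefXn.
  have [->|iK] := eqVneq i K.
    rewrite mulr1; apply: ratl_ext (ratl_shift K lamN) => n.
    by rewrite (entry_diag _ _ eig) eqxx.
  rewrite mulr0; apply: ratl_ext (ratl0 _ N) => n.
  by rewrite (entry_diag _ _ eig) eqn_add2l eq_sym (negPf iK).
case: i ki => // i; rewrite ltnS => ki; case: K kK => // K; rewrite ltnS => kK.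
have IHk j : (k <= j)%N -> ratl (N - k.+1).+1
    ((a N)`_N * (N ^_ k)%:R * (comm_symbol K.+1 k)`_j)
    (fun n => entry (T k) (n + K.+1) (n + j)).
  by rewrite subnSK //; apply: IH; rewrite ?leqW // ltnW.
set e := (N - k.+1)%N in IHk *.
have h0 := IHk i ki; have h1 := IHk i.+1 (leqW ki).
have h2 := IHk i.+2 (leqW (leqW ki)).
(* [d0] and [d2] contain differences along one diagonal, coming from the shift and its inverse; [d1]
   and [d3] contain variations of [b] and [c], which contribute nothing at order [e]. *)
have d0 := ratl_diff h0.
have d1 := ratl_jac_sub0 K i hb h1.
have d2 := ratlM (ratl_shift K hc) (ratl_pred (ratl_diff h2)).
have d3 := ratl_jac_sub0 K i.+1 hc h2.
have := ratlD (ratlB (ratlD d0 d1) d2) d3; rewrite !addr0.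
set al := _ - _; have -> : al =
    (a N)`_N * (N ^_ k.+1)%:R * (comm_symbol K.+1 k.+1)`_i.+1.
  rewrite coef_comm_symbolS // ffactnSr natrM /al /e subnSK //; ring.
apply: (@ratl_eventually _ _ _ _ _ 1) => -[//|n] _ /=.
rewrite !addnS entry_commX; last exact: iter_commX_linear.
by rewrite !addSn; ring.
Qed.

(** By the recurrence, composing with ['X] multiplies the leading symbol by [S + b0 + c0 / S] and
    keeps the order in [n] at zero. *)
Lemma ratl_entry_Xn K k i : (k <= K)%N -> (k <= i)%N ->
  ratl 0 (mul_symbol K k)`_i (fun n => entry (fun f => 'X^k * f) (n + K) (n + i)).
Proof.
elim: k K i => [|k IH] K i kK ki.
  rewrite /mul_symbol expr0 mulr1 subn0 coefXn.
  have id1 m : 'X^0 * P m = 1 *: P m by rewrite expr0 mul1r scale1r.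
  have [->|iK] := eqVneq i K.
    apply: ratl_ext (ratl_const 1) => n.
    by rewrite (@entry_diag (fun=> 1) _ _ _ id1) eqxx.
  apply: ratl_ext (ratl0 _ 0) => n.
  by rewrite (@entry_diag (fun=> 1) _ _ _ id1) eqn_add2l eq_sym (negPf iK).
case: i ki => // i; rewrite ltnS => ki; case: K kK => // K; rewrite ltnS => kK.
have IHk j : (k <= j)%N -> ratl 0 (mul_symbol K.+1 k)`_j
    (fun n => entry (fun f => 'X^k * f) (n + K.+1) (n + j)).
  by move=> kj; exact: IH (leqW kK) kj.
have h0 := IHk i ki; have h1 := IHk i.+1 (leqW ki).
have h2 := IHk i.+2 (leqW (leqW ki)).
have := ratlD (ratlD (ratl_shift 1 h0) (ratlM (ratl_shift K hb) h1))
  (ratlM (ratl_shift K hc) (ratl_pred h2)).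
rewrite -coef_mul_symbolS //.
apply: (@ratl_eventually _ _ _ _ _ 1) => -[//|n] _ /=.
have -> m m' : entry (fun f => 'X^(k.+1) * f) m m' =
    entry (fun f => 'X^k * ('X * f)) m m'.
  by rewrite /entry exprSr !mulrA.
rewrite !addnS entry_XP; last by move=> d f g; rewrite mulrDr scalerAr.
by rewrite addn0 !addSn.
Qed.

Hypothesis size_aN : (size (a N) <= N.+1)%N.

Lemma entry_commX_top n m : entry (T N) n m =
  N`!%:R * \sum_(j < N.+1) (a N)`_j * entry (fun f => 'X^j * f) n m.
Proof.
have eaN : a N = \sum_(j < N.+1) (a N)`_j *: 'X^j.
  apply/polyP => i; rewrite coef_sum; have [iN|Ni] := ltnP i N.+1.
    rewrite (bigD1 (Ordinal iN)) //= coefZ coefXn eqxx mulr1 big1 ?addr0 // => j.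
    by rewrite -val_eqE /= coefZ coefXn eq_sym => /negPf ->; rewrite mulr0.
  rewrite nth_default ?(leq_trans size_aN) // big1 // => j _.
  by rewrite coefZ coefXn gtn_eqF ?mulr0 // (leq_trans (ltn_ord j)).
have sumL (I : Type) (r : seq I) (F : I -> {poly R}) :
    L (\sum_(i <- r) F i) = \sum_(i <- r) L (F i).
  elim: r => [|i r IH]; first by rewrite !big_nil (functional0 L_lin).
  by rewrite !big_cons (functionalD L_lin) IH.
rewrite /entry iter_commX_dop_top [a N * _ *+ _ * _]mulrnAl (functionalMn L_lin) -[X in X / _ = _]mulr_natl -[X in X = _]mulrA.
congr (_ * _); rewrite {1}eaN !mulr_suml sumL mulr_suml.
by apply: eq_bigr => j _; rewrite -!scalerAl (functionalZ L_lin) mulrA.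
Qed.

(** Up to the factor [N!], both sides give the leading coefficients of the entries of the [N]-fold
    commutator, which are unique. With [K = N + N] both sides are divisible by [X^N], which settles
    the indices below [N]. *)
Lemma symbol_identity :
  \sum_(j < N.+1) (a N)`_j *: mul_symbol (N + N) j =
  (a N)`_N *: comm_symbol (N + N) N.
Proof.
apply/polyP => i; rewrite coefZ coef_sum.
have NN j : (j <= N)%N -> (N <= N + N - j)%N by lia.
have [iN|Ni] := ltnP i N.
  rewrite /comm_symbol coefXnM addnK iN mulr0 big1 // => j _.
  by rewrite coefZ /mul_symbol coefXnM (leq_trans iN) ?mulr0 // NN // -ltnS ltn_ord.
have N0 : N`!%:R != 0 :> R by rewrite pnatr_eq0 -lt0n fact_gt0.
apply: (mulIf N0).
have h1 := ratl_entry_commX (leq_addr N N) (leqnn N) Ni.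
rewrite subnn ffactnn in h1.
have jN (j : 'I_N.+1) : (j <= N)%N by rewrite -ltnS.
have h2 := ratl_sum (index_enum 'I_N.+1) (fun j : 'I_N.+1 => ratlZ ((a N)`_j)
  (ratl_entry_Xn (leq_trans (jN j) (leq_addr N N)) (leq_trans (jN j) Ni))).
have h3 := ratlZ N`!%:R h2.
under eq_bigr do rewrite coefZ.
rewrite [LHS]mulrC [RHS]mulrAC; apply: ratl_uniq h1.
by apply: ratl_ext h3 => n; rewrite entry_commX_top.
Qed.

(** The symbol identity is evaluated at [S = y], where [x = y + b0 + c0 / y]; squaring eliminates
    [y] because [(y - c0 / y)^2 = (x - b0)^2 - 4 c0]. *)
Lemma lead_sqr_on_curve x y : y != 0 -> y * x = y ^+ 2 + b0 * y + c0 ->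
  (a N).[x] ^+ 2 = (a N)`_N ^+ 2 * ((x - b0) ^+ 2 - 4%:R * c0) ^+ N.
Proof.
move=> y0 yx; have := congr1 (fun p : {poly R} => p.[y]) symbol_identity.
rewrite horner_sum hornerZ /comm_symbol /mul_symbol addnK.
rewrite !(hornerM, horner_exp, hornerD, hornerN, hornerC, hornerX).
have -> : \sum_(j < N.+1) ((a N)`_j *: ('X^(N + N - j) * ('X^2 + b0 *: 'X + c0%:P) ^+ j)).[y]
   = y ^+ (N + N) * (a N).[x].
  rewrite (horner_coef_wide _ size_aN) mulr_sumr; apply: eq_bigr => j _.
  rewrite !(hornerZ, hornerM, horner_exp, hornerD, hornerC, hornerX) -yx exprMn.
  have -> : y ^+ (N + N) = y ^+ (N + N - j) * y ^+ j.
    by rewrite -exprD subnK // (leq_trans _ (leq_addr _ _)) // -ltnS ltn_ord.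
  by ring.
move=> e; have yN : y ^+ (N + N) != 0 by rewrite expf_neq0.
apply: (mulfI (expf_neq0 2 yN)); rewrite -exprMn e.
have e2 : (y ^+ 2 - c0) ^+ 2 = y ^+ 2 * ((x - b0) ^+ 2 - 4%:R * c0).
  have -> : c0 = y * x - y ^+ 2 - b0 * y by rewrite yx; ring.
  by ring.
have e3 : ((y ^+ 2 - c0) ^+ N) ^+ 2 =
    y ^+ (N + N) * ((x - b0) ^+ 2 - 4%:R * c0) ^+ N.
  by rewrite exprAC e2 exprMn -exprM mul2n addnn.
by rewrite !exprMn e3 exprD; ring.
Qed.

Lemma lead_sqr : (a N) ^+ 2 =
  (a N)`_N ^+ 2 *: (('X - b0%:P) ^+ 2 - (4%:R * c0)%:P) ^+ N.
Proof.
apply/eqP; rewrite -subr_eq0; apply/negPn/negP; set H := _ - _ => H0.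
have lH : 0 < lead_coef (H ^+ 2) by rewrite lead_coef_exp exprn_even_gt0 //= lead_coef_eq0.
have [x0 hx] := poly_pinfty_gt_lc lH.
(* A large [y] gives a point [x] of the curve beyond [x0], where [H ^+ 2] should be positive
   although the curve identity makes [H] vanish. *)
pose n := (Num.bound (`|x0| + `|b0| + `|c0|)).+1.
pose y : R := n%:R; have y1 : 1 <= y by rewrite ler1n.
have hy : `|x0| + `|b0| + `|c0| <= y.
  by rewrite ltW // (lt_le_trans (archi_boundP _)) ?addr_ge0 // ler_nat.
have y0 : y != 0 by rewrite gt_eqF // (lt_le_trans ltr01).
pose x := y + b0 + c0 / y.
have hx0 : x0 <= x.
  have h1 : `|c0 / y| <= `|c0|.
    by rewrite normrM ler_piMr // normfV invf_le1 ?ger0_norm // (lt_le_trans ltr01).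
  have := ler_norm x0; have := ler_norm (- b0); have := ler_norm (- (c0 / y)).
  rewrite !normrN /x; lra.
have := hx x hx0; rewrite horner_exp.
have -> : H.[x] = 0.
  rewrite /H hornerD hornerN hornerZ !horner_exp.
  rewrite !(hornerD, hornerN, horner_exp, hornerC, hornerX).
  rewrite (@lead_sqr_on_curve x y) ?subrr // /x; field.
  by rewrite y0.
by rewrite expr0n leNgt lH.
Qed.
End Symbol.

(** * Vanishing of the leading coefficient at the endpoints *)

Lemma poly_bounded_itv (R : realFieldType) (p : {poly R}) (l r : R) :
  exists2 B, 0 < B & forall x, l <= x <= r -> `|p.[x]| <= B.
Proof.
elim/poly_ind: p => [|p c [B B0 hB]].
  by exists 1 => // x _; rewrite horner0 normr0.
exists (B * (`|l| + `|r|) + `|c| + 1).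
  by rewrite ltr_wpDl // addr_ge0 // mulr_ge0 ?addr_ge0 // ltW.
move=> x lxr; rewrite hornerMXaddC.
have hx : `|x| <= `|l| + `|r|.
  move: lxr => /andP[lx xr]; rewrite ler_norml; have := ler_norm r.
  have := ler_norm (- l); have := normr_ge0 r; have := normr_ge0 l.
  rewrite normrN; lra.
have h1 : `|p.[x] * x| <= B * (`|l| + `|r|) by rewrite normrM ler_pM // hB.
by have := ler_normD (p.[x] * x) c; lra.
Qed.

Lemma bernoulli (R : realFieldType) (t : R) n : 0 <= t -> 1 + n%:R * t <= (1 + t) ^+ n.
Proof.
move=> t0; elim: n => [|n IH]; first by rewrite mul0r addr0 expr0.
rewrite exprS; apply: le_trans (ler_wpM2l _ IH); last by rewrite addr_ge0.
rewrite -natr1; have : 0 <= t * (n%:R * t) by rewrite !mulr_ge0.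
by nra.
Qed.

(** Bernoulli's inequality for [u / v = 1 + t] pushes the ratio of the powers above [|C| / m]. *)
Lemma geometric_dominates (R : archiRealFieldType) (u v m C : R) (n0 : nat) :
  0 < v -> v < u -> 0 < m ->
  exists2 n, (n0 <= n)%N & C * v ^+ n < m * u ^+ n.
Proof.
move=> v0 vu m0; pose t := u / v - 1.
have t0 : 0 < t by rewrite subr_gt0 ltr_pdivlMr // mul1r.
pose k := Num.bound (`|C| / (m * t)); exists (maxn n0 k); first exact: leq_maxl.
set n := maxn n0 k.
have -> : u = v * (1 + t) by rewrite /t addrC subrK mulrC divfK // gt_eqF.
rewrite exprMn mulrCA [ltLHS]mulrC ltr_pM2l ?exprn_gt0 //.
have h1 : `|C| / (m * t) < n%:R.
  apply: lt_le_trans (archi_boundP _) _; last by rewrite ler_nat leq_maxr.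
  by rewrite divr_ge0 // mulr_ge0 // ltW.
have h2 := @bernoulli R t n (ltW t0).
have h3 : m * (1 + n%:R * t) <= m * (1 + t) ^+ n by rewrite ler_pM2l.
rewrite ltr_pdivrMr ?mulr_gt0 // in h1.
apply: (le_lt_trans (ler_norm C)); apply: (lt_le_trans h1).
apply: le_trans h3; have -> : m * (1 + n%:R * t) = m + n%:R * (m * t) by ring.
by rewrite lerDr ltW.
Qed.

Section Endpoint.
Variables (R : archiRealFieldType) (L : {poly R} -> R) (l r : R).
Hypothesis L_lin : forall c f g, L (c *: f + g) = c * L f + L g.
Hypothesis L_pos : forall f, (forall x, l <= x <= r -> 0 <= f.[x]) -> 0 <= L f.

(** Membership of [e] in the support, phrased through the functional alone: a mass of at least [m]
    lies within distance [d] of [e]. *)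
Definition charges (e : R) := forall d, 0 < d -> exists2 m, 0 < m &
  forall f : {poly R}, (forall x, l <= x <= r -> 0 <= f.[x]) ->
    (forall x, l <= x <= r -> `|x - e| <= d -> 1 <= f.[x]) -> m <= L f.

(* Testing the Pearson equation with large powers of an affine function that
   is maximal at the endpoint [e] of the support, the term [A f'] dominates
   near [e] if [A e] is not zero. *)
Lemma endpoint_root (A B : {poly R}) (N : nat) (e s : R) :
  (0 < N)%N -> l <= e <= r -> s ^+ 2 = 1 ->
  (forall x, l <= x <= r -> `|x - e| = s * (e - x)) ->
  charges e -> (forall f, L (A * f^`() *+ N + (B * f) *+ 2) = 0) -> root A e.
Proof.
move=> N0 er s2 abs_s che.
wlog sA : A B / 0 <= s * A.[e].
  move=> W LAB; have [|] := leP 0 (s * A.[e]); first by move/(W A B); apply.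
  move=> neg; rewrite -rootN; apply: (W (- A) (- B)).
    by rewrite hornerN mulrN oppr_ge0 ltW.
  move=> f; have -> : - A * f^`() *+ N + - B * f *+ 2 = -1 *: (A * f^`() *+ N + B * f *+ 2).
    by rewrite scaleN1r; ring.
  by rewrite (functionalZ L_lin) LAB mulr0.
move=> LAB; rewrite rootE; apply/negPn/negP => Ae0.
have s0 : s != 0 by apply/eqP => s0; move: s2; rewrite s0 expr0n /= => /eqP; rewrite eq_sym oner_eq0.
have {sA} sA : 0 < s * A.[e] by rewrite lt_neqAle sA eq_sym mulf_neq0.
set eta := s * A.[e] / 2%:R.
have eta0 : 0 < eta by rewrite divr_gt0.
have [d [d0 d1 hd]] : exists d, [/\ 0 < d, d < 1 &
    forall x, l <= x <= r -> `|x - e| <= d -> eta <= s * A.[x]].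
  have /factor_theorem [g eg] : root (A - A.[e]%:P) e by rewrite rootE !hornerE subrr.
  have [G G0 hG] := poly_bounded_itv g l r.
  exists (Num.min (1 / 2%:R) (eta / G)); split.
  - by rewrite lt_min !divr_gt0.
  - by rewrite gt_min; apply/orP; left; lra.
  move=> x xlr; rewrite le_min => /andP[_]; rewrite ler_pdivlMr // => xe.
  have eA : A.[x] = A.[e] + g.[x] * (x - e).
    have := congr1 (fun p : {poly R} => p.[x]) eg; rewrite !hornerE; lra.
  have s1 : `|s| = 1.
    have /eqP : `|s| ^+ 2 = 1 by rewrite -normrX s2 normr1.
    by rewrite sqrp_eq1 // => /eqP.
  have : `|s * (g.[x] * (x - e))| <= eta.
    rewrite !normrM s1 mul1r mulrC; apply: le_trans xe.
    by rewrite ler_wpM2l // hG.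
  rewrite ler_norml => /andP[h1 _]; rewrite eA mulrDr.
  have : s * A.[e] = eta + eta by rewrite /eta; lra.
  lra.
have [M1 M10 hM1] := poly_bounded_itv A l r.
(* With this constant the affine [q] equals [C - |x - e|] on the interval: it is at least 1 there
   and peaks at [e]. *)
pose C := 1 + (r - l).
pose q : {poly R} := C%:P + s *: ('X - e%:P).
have qx x : l <= x <= r -> q.[x] = C - `|x - e|.
  by move=> xlr; rewrite abs_s // /q !hornerE; ring.
have q1 x : l <= x <= r -> 1 <= q.[x].
  move=> xlr; rewrite qx // /C.
  have : `|x - e| <= r - l by rewrite ler_norml; move: xlr er => /andP[? ?] /andP[? ?]; lra.
  lra.
have dq : q^`() = s%:P.
  by rewrite /q derivD derivC add0r derivZ derivXsubC alg_polyC.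
have [M2 M20 hM2] := poly_bounded_itv (B * q *+ 2) l r.
have [mu mu0 hmu] := che (d / 2%:R) (divr_gt0 d0 (ltr0Sn _ 1)).
have C1 : 1 <= C by move: er => /andP[? ?]; rewrite /C; lra.
pose K := N%:R * M1 + M2; pose L1 := L 1.
have K0 : 0 < K by rewrite addr_gt0 // mulr_gt0 ?ltr0n.
have L10 : 0 <= L1 by apply: L_pos => x _; rewrite hornerC.
(* [n0] makes [(n + 1) eta] at least twice the contribution [M2] of [B]; the choice of [n] makes the
   growth within [d / 2] of [e] beat the growth beyond [d]. *)
pose n0 := Num.bound (M2 * 2%:R / eta).
have [n nn0 hn] : exists2 n, (n0 <= n)%N &
    K * L1 * (C - d) ^+ n < mu * (eta / 2%:R) * (C - d / 2%:R) ^+ n.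
  apply: geometric_dominates.
  - by rewrite subr_gt0 (lt_le_trans d1).
  - rewrite ltrD2l ltrN2; lra.
  - by rewrite mulr_gt0 // divr_gt0.
have hn0 : M2 * 2%:R <= n.+1%:R * eta.
  rewrite -ler_pdivrMr //; apply: ltW.
  apply: lt_le_trans (archi_boundP _) _; last by rewrite ler_nat; exact: leqW nn0.
  by apply: divr_ge0; [exact: mulr_ge0 (ltW M20) _|exact: ltW].
have NR : 1 <= N%:R :> R by rewrite ler1n.
have n1 : 0 < n.+1%:R :> R by rewrite ltr0n.
pose g := A * (q ^+ n.+1)^`() *+ N + (B * q ^+ n.+1) *+ 2.
have gx x : g.[x] = q.[x] ^+ n *
    (n.+1%:R * (N%:R * (s * A.[x])) + (B * q *+ 2).[x]).
  rewrite /g deriv_exp dq /= !(hornerD, hornerMn, hornerM, hornerC, horner_exp) exprS.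
  by ring.
have q0 x : l <= x <= r -> 0 <= q.[x].
  by move=> xlr; rewrite (le_trans ler01) ?q1.
have eta20 : 0 <= eta / 2%:R by rewrite ltW // divr_gt0.
(* [D] bounds [|g|] at distance more than [d] from [e], so [f = g + D] is nonnegative on the whole
   interval, while [L g = 0] by the Pearson equation. *)
pose D := (C - d) ^+ n * (n.+1%:R * K).
have D0 : 0 <= D by rewrite !mulr_ge0 ?exprn_ge0 ?ltW //; lra.
pose f := g + D%:P.
have Lf : L f = D * L1.
  by rewrite /f -alg_polyC (functionalD L_lin) LAB add0r (functionalZ L_lin).
have M1E x : l <= x <= r -> `|s * A.[x]| <= M1.
  have s1 : `|s| = 1.
    have /eqP : `|s| ^+ 2 = 1 by rewrite -normrX s2 normr1.
    by rewrite sqrp_eq1 // => /eqP.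
  by move=> xlr; rewrite normrM s1 mul1r hM1.
have lower x : l <= x <= r -> `|x - e| <= d ->
    q.[x] ^+ n * (n.+1%:R * (eta / 2%:R)) <= g.[x].
  move=> xlr xd; rewrite gx; apply: ler_wpM2l.
    by rewrite exprn_ge0 // q0.
  have := hM2 x xlr; rewrite ler_norml => /andP[h1 _].
  have h2 : n.+1%:R * eta <= n.+1%:R * (N%:R * (s * A.[x])).
    rewrite ler_pM2l //; apply: le_trans (hd x xlr xd) _.
    by rewrite ler_peMl // (le_trans (ltW eta0)) // hd.
  have -> : n.+1%:R * (eta / 2%:R) = n.+1%:R * eta / 2%:R by rewrite mulrA.
  lra.
have fpos x : l <= x <= r -> 0 <= f.[x].
  move=> xlr; rewrite /f hornerD hornerC; have [xd|xd] := leP `|x - e| d.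
    apply: addr_ge0 => //; apply: le_trans (lower x xlr xd).
    by apply: mulr_ge0; [exact: exprn_ge0 (q0 _ xlr)|exact: mulr_ge0 (ler0n _ _) eta20].
  rewrite -lerBlDr sub0r; suff : `|g.[x]| <= D by rewrite ler_norml => /andP[].
  rewrite gx normrM /D; apply: ler_pM => //.
    rewrite normrX ger0_norm ?q0 //.
    apply: lerXn2r; rewrite ?nnegrE ?q0 //; first by lra.
    by rewrite qx // lerD2l lerN2 ltW.
  apply: (le_trans (ler_normD _ _)); rewrite /K [leRHS]mulrDr; apply: lerD.
    rewrite !normrM [`|n.+1%:R|]ger0_norm // [`|N%:R|]ger0_norm //.
    by rewrite -[`|s| * _]normrM ler_pM2l // ler_wpM2l ?M1E.
  apply: (le_trans (hM2 x xlr)); rewrite ler_peMl ?ler1n //; exact: ltW.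
(* [V] is a lower bound of [g] within [d / 2] of [e], so [f / V] can be tested against the mass
   there; the resulting [mu * V <= D * L1] contradicts the choice of [n]. *)
pose V := (C - d / 2%:R) ^+ n * (n.+1%:R * (eta / 2%:R)).
have V0 : 0 < V.
  apply: mulr_gt0; last by apply: mulr_gt0 => //; exact: divr_gt0.
  by apply: exprn_gt0; lra.
have : mu <= L (V^-1 *: f).
  apply: hmu => x xlr; first by rewrite hornerZ mulr_ge0 ?invr_ge0 ?(ltW V0) ?fpos.
  move=> xd; rewrite hornerZ mulrC ler_pdivlMr // mul1r /f hornerD hornerC.
  rewrite -[V]addr0; apply: lerD => //; apply: le_trans (lower x xlr _); last by lra.
  apply: ler_wpM2r; first by rewrite mulr_ge0.
  apply: lerXn2r; rewrite ?nnegrE ?q0 //; first by lra.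
  by rewrite qx // lerD2l lerN2.
rewrite (functionalZ L_lin) Lf mulrC ler_pdivlMr // /V /D leNgt => /negP; apply.
have -> : (C - d) ^+ n * (n.+1%:R * K) * L1 = n.+1%:R * (K * L1 * (C - d) ^+ n) by ring.
have -> : mu * ((C - d / 2%:R) ^+ n * (n.+1%:R * (eta / 2%:R))) =
  n.+1%:R * (mu * (eta / 2%:R) * (C - d / 2%:R) ^+ n) by ring.
by rewrite ltr_pM2l.
Qed.
End Endpoint.

(** * The theorem for real operators and positive functionals *)

Theorem real_bochner_krall (R : archiRealFieldType) (L : {poly R} -> R)
    (l r : R) (p : nat -> {poly R}) (N : nat) (a : nat -> {poly R}) :
  (forall c f g, L (c *: f + g) = c * L f + L g) ->
  (forall f : {poly R}, (forall x, l <= x <= r -> 0 <= f.[x]) -> 0 <= L f) ->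
  charges L l r l -> charges L l r r ->
  (forall n, size (p n) = n.+1) ->
  (forall n m, L (p n * p m) <> 0 <-> n = m) ->
  (0 < N)%N -> a 0 = 0 -> a N != 0 ->
  (forall n, exists lam, dop N a (p n) = lam *: p n) ->
  ~~ odd N /\ exists c, a N = c *: (('X - l%:P) * ('X - r%:P)) ^+ N./2.
Proof.
move=> L_lin L_pos chl chr p_size p_orth N0 a0 aN p_eig.
pose P n := (lead_coef (p n))^-1 *: p n.
have lc0 n : lead_coef (p n) != 0 by rewrite lead_coef_eq0 -size_poly_gt0 p_size.
have P_monic n : P n \is monic by rewrite monicE lead_coefZ mulVf.
have P_size n : size (P n) = n.+1 by rewrite size_scale ?invr_eq0.
have L_PP n m : L (P n * P m) = (lead_coef (p n))^-1 * ((lead_coef (p m))^-1 * L (p n * p m)).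
  by rewrite /P -scalerAl -scalerAr !(functionalZ L_lin).
have P_orth n m : n != m -> L (P n * P m) = 0.
  move=> nm; rewrite L_PP; have [->|/eqP/p_orth e] := eqVneq (L (p n * p m)) 0.
    by rewrite !mulr0.
  by rewrite e eqxx in nm.
have P_pos n : 0 < L (P n * P n).
  rewrite lt_neqAle eq_sym L_PP !mulf_neq0 ?invr_eq0 //; last exact/eqP/p_orth.
  by rewrite -L_PP; apply: L_pos => x _; rewrite hornerM -expr2 sqr_ge0.
have [lam eig] : exists lam : nat -> R, forall n, dop N a (P n) = lam n *: P n.
  have [lam hlam] := choice p_eig; exists lam => n.
  have := dop_linear N a (lead_coef (p n))^-1 (p n) 0.
  rewrite !addr0 dop0 addr0 -/(P n) => ->.
  by rewrite hlam scalerA mulrC -scalerA.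
(* Otherwise positivity would force [L] to vanish on every polynomial that is zero at [l], among
   them [P 1 * ('X - l%:P)]. *)
have lr : l < r.
  rewrite ltNge; apply/negP => rl.
  have vanish f : f.[l] = 0 -> L f = 0.
    move=> fl; have h g : g.[l] = 0 -> 0 <= L g.
      move=> gl; apply: L_pos => x /andP[lx xr].
      have -> : x = l by apply/le_anti; rewrite lx (le_trans xr rl).
      by rewrite gl.
    apply/le_anti; rewrite h // andbT -oppr_ge0 -(functionalN L_lin) h //.
    by rewrite hornerN fl oppr0.
  have := P_pos 1; rewrite -(orth_monic L_lin P_monic P_size P_orth (monicXsubC l) (size_XsubC l)).
  by rewrite vanish ?ltxx // hornerM hornerXsubC subrr mulr0.
have evN := order_even L_lin P_monic P_size P_orth P_pos aN eig.
split=> //.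
have pear := fun f => pearson L_lin P_monic P_size P_orth P_pos aN eig f N0.
have rl : root (a N) l.
  apply: (endpoint_root (s := -1) L_lin L_pos N0 _ _ _ chl pear).
  - by rewrite lexx ltW.
  - by rewrite sqrrN expr1n.
  - by move=> x /andP[lx _]; rewrite ger0_norm ?subr_ge0 // mulN1r opprB.
have rr : root (a N) r.
  apply: (endpoint_root (s := 1) L_lin L_pos N0 _ _ _ chr pear).
  - by rewrite lexx ltW.
  - by rewrite expr1n.
  - by move=> x /andP[_ xr]; rewrite distrC ger0_norm ?subr_ge0 // mul1r.
have [b0 hb] := ratf_bounded (jac_b_bounded L_lin P_pos L_pos)
  (ratf_jac_b L_lin P_monic P_size P_orth P_pos a0 aN eig).
have [c0 hc] := ratf_bounded (jac_c_bounded L_lin P_monic P_size P_orth P_pos L_pos)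
  (ratf_jac_c L_lin P_monic P_size P_orth P_pos a0 aN eig).
have lamN := ratl_eigenvalue P_monic P_size eig.
have saN := size_lead_leq P_size eig.
have := lead_sqr L_lin P_monic P_size P_orth P_pos hb hc eig lamN saN.
set al := _`_N; set q := _ - _ => sqr.
have al0 : al != 0.
  by apply: contra_neq aN => al0; apply/eqP; rewrite -sqrf_eq0 sqr al0 expr0n scale0r.
have qroot e : root (a N) e -> q.[e] = 0.
  move=> /rootP re; have := congr1 (fun f : {poly R} => f.[e]) sqr.
  rewrite hornerZ !horner_exp re expr0n /= => /esym/eqP.
  by rewrite mulf_eq0 expf_eq0 (negPf al0) /= expf_eq0 N0 /= => /eqP.
have ql := qroot _ rl; have qr := qroot _ rr.
(* The quadratic [q] is monic with the distinct roots [l] and [r], which determine [b0] and [c0]. *)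
have eq : q = ('X - l%:P) * ('X - r%:P).
  move: ql qr; rewrite /q !(hornerD, hornerN, horner_exp, hornerC, hornerX) => ql qr.
  have bE : 2%:R * b0 = l + r.
    have : (r - l) * (l + r - 2%:R * b0) = 0 by nra.
    by move/eqP; rewrite mulf_eq0 subr_eq0 gt_eqF //= => /eqP; lra.
  have cE : b0 ^+ 2 - 4%:R * c0 = l * r by nra.
  have -> : ('X - b0%:P) ^+ 2 - (4%:R * c0)%:P =
    'X ^+ 2 - (2%:R * b0)%:P * 'X + (b0 ^+ 2 - 4%:R * c0)%:P.
    by rewrite !(polyCD, polyCN, polyCM, polyC_exp, polyC_natr); ring.
  by rewrite bE cE polyCD polyCM; ring.
have : (a N) ^+ 2 = (al *: (('X - l%:P) * ('X - r%:P)) ^+ N./2) ^+ 2.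
  rewrite sqr eq exprZn -exprM -[in LHS](odd_double_half N) (negPf evN) add0n.
  by rewrite muln2.
move/eqP; rewrite eqf_sqr => /orP[/eqP ->|/eqP ->]; first by exists al.
by exists (- al); rewrite scaleNr.
Qed.

(** * From the measure to a positive functional *)

Section MeasureSupport.
Variables (R : realType) (mu : {measure set (measurableTypeR R) -> \bar R}).

Lemma not_support_null x : ~ measure_support mu x ->
  exists e : R, 0 < e /\ mu `]x - e, x + e[%classic = 0%E.
Proof.
move=> /existsNP[U /not_implyP[oU /not_implyP[Ux /negP]]].
rewrite -leNgt => mU0.
have mUE : mu U = 0%E by apply/eqP; rewrite eq_le mU0 measure_ge0.
have [e /= e0 eU] := open_subball oU Ux.
exists (e / 2); split; first by rewrite divr_gt0.
apply/eqP; rewrite eq_le measure_ge0 andbT -mUE.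
apply: le_measure; rewrite ?inE //; first exact: open_measurable.
have e20 : 0 < e / 2 by rewrite divr_gt0.
have be : ball_ [eta Num.Def.normr] 0 e (e / 2).
  by rewrite /= sub0r normrN gtr0_norm // gtr_pMr // invf_lt1 // ltr1n.
move=> y /=; rewrite in_itv /= => yx; apply: (eU _ be e20).
by rewrite -ball_normE /= ltr_distlC.
Qed.

(** Second countability: points outside the support are covered by the countably many intervals with
    rational ends and measure zero. *)
Lemma null_outside_support (A : set R) : measurable (A : set (measurableTypeR R)) ->
  (forall x, A x -> ~ measure_support mu x) -> mu A = 0%E.
Proof.
move=> mA hA; apply: measure_negligible => //.
pose F n : set (measurableTypeR R) := if @unpickle (rat * rat)%type n is Some (p, q) then
  if mu `]ratr p, ratr q[%classic == 0%E then `]ratr p, ratr q[%classic else set0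
  else set0.
have : mu.-negligible (\bigcup_n F n).
  apply: negligible_bigcup => n; rewrite /F; case: unpickle => [[p q]|]; last exact: negligible_set0.
  by case: eqP => [mF|_]; [exists `]ratr p, ratr q[%classic; split|exact: negligible_set0].
apply: negligibleS => x /hA /not_support_null[e [e0 me]].
have [p] : exists p : rat, ratr p \in `]x - e, x[ by apply: rat_in_itvoo; lra.
rewrite in_itv /= => /andP[p1 p2].
have [q] : exists q : rat, ratr q \in `]x, x + e[ by apply: rat_in_itvoo; lra.
rewrite in_itv /= => /andP[q1 q2].
exists (pickle (p, q)); [exact: I|rewrite /F pickleK].
suff -> : mu `]ratr p, ratr q[%classic = 0%E by rewrite eqxx /= in_itv /= p2 q1.
apply/eqP; rewrite eq_le measure_ge0 andbT -me; apply: le_measure; rewrite ?inE //.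
by move=> y /=; rewrite !in_itv /= => /andP[? ?]; apply/andP; split; lra.
Qed.
End MeasureSupport.

Section PolynomialIntegral.
Variables (R : realType) (mu : {measure set (measurableTypeR R) -> \bar R}).
Variables (l r : R).
Hypothesis hull : convex_hull (measure_support mu) = `[l, r]%classic.
Hypothesis mu_fin : (mu setT < +oo)%E.
Hypothesis mu_neq0 : mu setT != 0%E.

Lemma null_outside_itv : mu (~` `[l, r]%classic) = 0%E.
Proof.
apply: null_outside_support; first exact: measurableC.
by move=> x nx sx; apply: nx; rewrite -hull; exact: sub_gen_smallest sx.
Qed.

Lemma hull_itv_leq : l <= r.
Proof.
rewrite leNgt; apply: contra mu_neq0 => rl.
by rewrite -null_outside_itv set_itv_ge -?leNgt ?bnd_simp ?setC0 // -ltNge.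
Qed.

Lemma convex_set_itvcc (a b : R) : @convex_set R R^o `[a, b]%classic.
Proof.
move=> x y t; rewrite !inE /= !in_itv /= => /andP[ax xb] /andP[ay yb].
have t0 : 0 <= t%:num by [].
have t1 : t%:num <= 1 by [].
change (a <= t%:num * (x : R) + (1 - t%:num) * (y : R) <= b).
have s0 : 0 <= 1 - t%:num by rewrite subr_ge0.
move: (t%:num) (1 - t%:num) t0 s0 (subrK (t%:num) 1) => u v u0 v0 uv.
have h1 : u * a <= u * (x : R) by exact: ler_wpM2l.
have h2 : v * a <= v * (y : R) by exact: ler_wpM2l.
have h3 : u * (x : R) <= u * b by exact: ler_wpM2l.
have h4 : v * (y : R) <= v * b by exact: ler_wpM2l.
have ea : u * a + v * a = a by rewrite -mulrDl addrC uv mul1r.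
have eb : u * b + v * b = b by rewrite -mulrDl addrC uv mul1r.
by rewrite -[X in X <= _]ea -[X in _ && (_ <= X)]eb !lerD.
Qed.

(** Otherwise a neighbourhood of [e] misses the support, which then lies in a closed interval
    avoiding [e]; that interval is convex and so contains the hull. *)
Lemma endpoint_in_support e : e = l \/ e = r -> measure_support mu e.
Proof.
move=> ee; apply: contrapT => /not_support_null[d [d0 md]].
have nsupp x : e - d < x < e + d -> ~ measure_support mu x.
  move=> xed /(_ `]e - d, e + d[%classic); rewrite md ltxx => h.
  suff : false by []. by apply: h; [exact: interval_open|rewrite /= in_itv].
have lr := hull_itv_leq.
have [a [b [ab ne]]] : exists a b,
    measure_support mu `<=` `[a, b]%classic /\ ~ (`[a, b]%classic e).
  have sub x : measure_support mu x -> l <= x <= r.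
    move=> sx; have : `[l, r]%classic x by rewrite -hull; exact: sub_gen_smallest sx.
    by rewrite /= in_itv.
  case: ee => ee.
  - exists (l + d), r; split=> [x sx|]; last by rewrite /= in_itv /= ee; lra.
    have /andP[lx xr] := sub x sx; rewrite /= in_itv /= xr andbT leNgt.
    by apply/negP => xd; apply: (nsupp x) => //; apply/andP; split; lra.
  - exists l, (r - d); split=> [x sx|]; last by rewrite /= in_itv /= ee; lra.
    have /andP[lx xr] := sub x sx; rewrite /= in_itv /= lx /= leNgt.
    by apply/negP => xd; apply: (nsupp x) => //; apply/andP; split; lra.
have hsub : convex_hull (measure_support mu) `<=` `[a, b]%classic.
  by apply: smallest_sub => //; exact: convex_set_itvcc.
apply: ne; apply: (hsub e); rewrite hull /= in_itv /=.
by case: ee => ->; rewrite lexx ?andbT.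
Qed.

(** On the interval every polynomial is bounded, hence integrable for a finite measure. *)
Definition itv_integral (f : {poly R}) : R := \int[mu]_(x in `[l, r]%classic) f.[x].

Lemma measurable_horner (f : {poly R}) (A : set (measurableTypeR R)) :
  measurable_fun A (fun x => f.[x]).
Proof.
apply/measurable_funTS; apply: continuous_measurable_fun; exact: continuous_horner.
Qed.

Lemma mu_itv_fin (A : set (measurableTypeR R)) : measurable A -> (mu A < +oo)%E.
Proof.
by move=> mA; apply: le_lt_trans mu_fin; apply: le_measure; rewrite ?inE.
Qed.

Lemma integrable_horner (f : {poly R}) (A : set (measurableTypeR R)) :
  measurable A -> A `<=` `[l, r]%classic ->
  mu.-integrable A (EFin \o (fun x => f.[x])).
Proof.
move=> mA Alr; apply: measurable_bounded_integrable => //.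
- exact: mu_itv_fin.
- exact: measurable_horner.
have [B B0 hB] := poly_bounded_itv f l r.
exists B; split; first exact: num_real.
move=> M BM x /Alr; rewrite /= in_itv /= => xlr.
exact: le_trans (hB x xlr) (ltW BM).
Qed.

Lemma itv_integral_linear c f g :
  itv_integral (c *: f + g) = c * itv_integral f + itv_integral g.
Proof.
rewrite /itv_integral; under eq_Rintegral do rewrite hornerD hornerZ.
have ii h : mu.-integrable `[l, r]%classic (EFin \o (fun x => h.[x])).
  exact: integrable_horner.
rewrite RintegralD //; first by rewrite RintegralZl.
have -> : (EFin \o (fun x => c * f.[x])) = (EFin \o (fun x => (c *: f).[x])).
  by apply/funext => x /=; rewrite hornerZ.
exact: ii.
Qed.

Lemma itv_integral_ge0 (f : {poly R}) :
  (forall x, l <= x <= r -> 0 <= f.[x]) -> 0 <= itv_integral f.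
Proof.
by move=> f0; apply: Rintegral_ge0 => x; rewrite /= in_itv /=; exact: f0.
Qed.

(** The mass is that of the part of the [d]-neighbourhood of [e] inside the interval; it is positive
    because the outside is null. *)
Lemma charges_endpoint e : e = l \/ e = r -> charges itv_integral l r e.
Proof.
move=> /endpoint_in_support se d d0.
pose U := `]e - d, e + d[%classic : set (measurableTypeR R).
pose B : set (measurableTypeR R) := `[l, r]%classic `&` U.
have mB : measurable B by apply: measurableI; exact: measurable_itv.
have B0 : (0 < mu B)%E.
  have : (0 < mu U)%E.
    apply: se; first exact: (@interval_open R (BRight (e - d)) (BLeft (e + d))).
    by rewrite /U /= in_itv /=; apply/andP; split; lra.
  move/lt_le_trans; apply.
  have mC : measurable (~` `[l, r]%classic : set (measurableTypeR R)).
    by apply: measurableC; exact: measurable_itv.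
  have hU : (mu (B `|` ~` `[l, r]) <= mu B + mu (~` `[l, r]))%E := measureU2 mu mB mC.
  rewrite null_outside_itv adde0 in hU; apply: le_trans hU.
  apply: le_measure; rewrite ?inE; [exact: measurable_itv|exact: measurableU|].
  move=> x Ux; have [xlr|xlr] := pselect (`[l, r]%classic x); last by right.
  by left; split.
have Bfin := mu_itv_fin mB.
exists (fine (mu B)); first by rewrite fine_gt0 // B0 Bfin.
have mI : measurable (`[l, r]%classic : set (measurableTypeR R)) by exact: measurable_itv.
move=> f f0 f1; rewrite /itv_integral /Rintegral.
have mf : measurable_fun (`[l, r]%classic : set (measurableTypeR R)) (fun x => (f.[x])%:E).
  by apply/measurable_EFinP; exact: measurable_horner.
apply: fine_le.
- by rewrite ge0_fin_numE ?measure_ge0.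
- by apply: integrable_fin_num => //; exact: integrable_horner.
have -> : mu B = (\int[mu]_(x in B) cst 1 x)%E by rewrite integral_cst ?mul1e.
apply: (@le_trans _ _ (\int[mu]_(x in B) (f.[x])%:E)%E).
  apply: ge0_le_integral => //.
  - by apply: measurable_funS mf => // x [].
  - move=> x [xlr xU]; rewrite /cst /= lee_fin; move: xlr xU; rewrite /U /= !in_itv /= => xlr xU.
    by apply: f1 => //; rewrite ler_norml; move: xU => /andP[? ?]; apply/andP; split; lra.
apply: ge0_subset_integral => //.
by move=> x [].
Qed.

Lemma poly_innerE p q : poly_inner mu p q = itv_integral (p * q).
Proof.
rewrite /poly_inner /itv_integral /Rintegral; congr fine.
under eq_integral do rewrite -hornerM.
have mI : measurable (`[l, r]%classic : set (measurableTypeR R)) by exact: measurable_itv.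
have mf : measurable_fun setT (fun x : measurableTypeR R => ((p * q).[x])%:E).
  by apply/measurable_EFinP; exact: measurable_horner.
rewrite [RHS]integral_mkcond; apply: ae_eq_integral => //.
- exact: (measurable_restrictT _ mI).1 (measurable_funTS mf).
exists (~` `[l, r]%classic); split; [exact: measurableC|exact: null_outside_itv|].
move=> x /= nx xlr; apply: nx => _; rewrite /patch mem_set //.
Qed.
End PolynomialIntegral.

(** * Reduction of complex coefficients to real and imaginary parts *)

Section RealPart.
Variables (R : realType) (phi : {additive R[i] -> R}).
Hypothesis phiM : forall (x : R[i]) (y : R), phi (x * (y%:C)%C) = phi x * y.

Lemma map_poly_mul_complexify (a : {poly R[i]}) (q : {poly R}) :
  map_poly phi (a * complexify q) = map_poly phi a * q.
Proof.
apply/polyP => i; rewrite coef_map !coefM raddf_sum; apply: eq_bigr => j _.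
by rewrite coef_map /complexify coef_map phiM.
Qed.

Lemma map_poly_diff_op N (a : nat -> {poly R[i]}) (q : {poly R}) :
  map_poly phi (diff_op N a (complexify q)) =
  dop N (fun k => if k == 0 then 0 else map_poly phi (a k)) q.
Proof.
rewrite /dop big_ord_recl eqxx mul0r add0r /diff_op big_add1 big_mkord.
rewrite raddf_sum; apply: eq_bigr => k _; rewrite lift0.
have := map_poly_mul_complexify (a k.+1) q^`(k.+1).
by rewrite /complexify -derivn_map.
Qed.
End RealPart.

(** As the [p n] are real, applying [phi], the real or imaginary part, to the coefficients of the
    operator leaves them eigenpolynomials, with [phi] of the eigenvalues. *)
Lemma real_part_bochner_krall (R : realType)
    (mu : {measure set (measurableTypeR R) -> \bar R}) (N : nat)
    (a : nat -> {poly R[i]}) (p : nat -> {poly R}) (l r : R)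
    (phi : {additive R[i] -> R}) :
  (forall (x : R[i]) (y : R), phi (x * (y%:C)%C) = phi x * y) ->
  compact_bochner_krall mu N a p ->
  convex_hull (measure_support mu) = `[l, r]%classic ->
  map_poly phi (a N) != 0 ->
  ~~ odd N /\ exists c,
    map_poly phi (a N) = c *: (('X - l%:P) * ('X - r%:P)) ^+ N./2.
Proof.
move=> phiM [p_size _ p_orth N0 _ p_eig] hull aN.
(* An infinite total mass is read as 0 by [fine], so infinite and zero masses alike would make the
   inner product of [p 0] with itself vanish. *)
have mu0 : fine (mu setT) != 0.
  have p0 := (p_orth 0 0).2 erefl; apply/eqP => mu0; apply: p0.
  rewrite /poly_inner [p 0]size1_polyC ?p_size //.
  under eq_Rintegral do rewrite hornerC.
  by rewrite Rintegral_cst // mu0 mulr0.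
have mu_fin : (mu setT < +oo)%E.
  by move: mu0; case: (mu setT) (measure_ge0 mu setT) => [x _ _||] //=; rewrite ?ltry ?eqxx.
have mu_neq0 : mu setT != 0%E by apply: contraNneq mu0 => ->.
(* [diff_op] starts at order one and [dop] at order zero, hence the zero coefficient put there. *)
pose a' k := if k == 0 then 0 else map_poly phi (a k).
have aNE : a' N = map_poly phi (a N) by rewrite /a' gtn_eqF.
rewrite -aNE.
apply: (@real_bochner_krall _ (itv_integral mu l r) l r p N a') => //.
- exact: itv_integral_linear.
- exact: itv_integral_ge0.
- by apply: charges_endpoint => //; left.
- by apply: charges_endpoint => //; right.
- by move=> n m; rewrite -(poly_innerE hull).
- by rewrite aNE.
- move=> n; have [lam hlam] := p_eig n; exists (phi lam).
  rewrite -map_poly_diff_op // hlam; apply/polyP => i.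
  by rewrite coefZ coef_map coefZ /complexify coef_map phiM.
Qed.

Theorem mainTheorem1 (R : realType)
    (mu : {measure set (measurableTypeR R) -> \bar R}) (N : nat)
    (a : nat -> {poly R[i]}) (p : nat -> {poly R}) (l r : R)
    (hBK : compact_bochner_krall mu N a p)
    (hhull : convex_hull (measure_support mu) = `[l, r]%classic) :
  ~~ odd N /\
  exists c : R[i],
    a N = c *: complexify (('X - l%:P) * ('X - r%:P)) ^+ (N./2).
Proof.
pose re : {additive R[i] -> R} := (@complex.Re R : {additive R[i] -> R}).
pose im : {additive R[i] -> R} := (@complex.Im R : {additive R[i] -> R}).
have reM (x : R[i]) (y : R) : re (x * (y%:C)%C) = re x * y by case: x => u v /=; ring.
have imM (x : R[i]) (y : R) : im (x * (y%:C)%C) = im x * y by case: x => u v /=; ring.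
have h1 := real_part_bochner_krall reM hBK hhull.
have h2 := real_part_bochner_krall imM hBK hhull.
set W := _ * _ in h1 h2 *.
have aE : a N = complexify (map_poly re (a N)) + 'i%C *: complexify (map_poly im (a N)).
  apply/polyP => i; rewrite coefD coefZ /complexify !coef_map /=.
  by rewrite [LHS]complexE.
(* At least one of the two parts of [a N] is nonzero, and the real case applies to it; a part that
   vanishes is the zero multiple. *)
have evN : ~~ odd N.
  have [re0|/h1[]//] := eqVneq (map_poly re (a N)) 0.
  have [im0|/h2[]//] := eqVneq (map_poly im (a N)) 0.
  by case: (bk_lead_neq0 hBK); rewrite aE re0 im0 /complexify !rmorph0 scaler0 addr0.
have pick (q : {poly R}) : (q != 0 -> ~~ odd N /\ exists c, q = c *: W ^+ N./2) ->
    exists c, q = c *: W ^+ N./2.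
  by have [-> _|_ /(_ isT)[]//] := eqVneq q 0; exists 0; rewrite scale0r.
have [c1 e1] := pick _ h1; have [c2 e2] := pick _ h2.
split=> //; exists (c1%:C + 'i%C * c2%:C)%C.
rewrite aE e1 e2 /complexify !map_polyZ !rmorphXn /= scalerA -scalerDl.
by [].
Qed.
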